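(* Let $d \geq 2$ be an integer, let $q$ be a prime power with $q^2 \equiv 1 \pmod d$, and let $k$ be a positive integer. Choose $v_1, v_2, \ldots, v_k \in \mathbb{F}_{q^2} \setminus \mathbb{F}_q$, no two of which are Galois conjugates. Let $M$ be the number of solutions $x$ in $\mathbb{F}_q$ to the system of equations $(x-v_i)^{(q^2-1)/d}=1$ for $1 \leq i \leq k$. Then $$ \bigg |M- \frac{q}{d^k}\bigg|\leq (2k-1)\sqrt{q}. $$
   Context: $\mathbb{F}_q$ denotes the finite field with $q$ elements. Elements $v,w\in\mathbb{F}_{q^2}$ are Galois conjugates (with respect to $\mathbb{F}_{q^2}/\mathbb{F}_q$) if $w=v$ or $w = v^q$; ''no two of which are Galois conjugates'' means that $v_i$ and $v_j$ are not Galois conjugates whenever $i\neq j$. *)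

(* Defs.v *)
From mathcomp Require Import all_boot all_order all_algebra all_field.
Set Implicit Arguments.
Unset Strict Implicit.
Unset Printing Implicit Defensive.
Import GRing.Theory Num.Theory.
Local Open Scope ring_scope.

(* The Galois group of F_{q^2} over F_q is {id, x |-> x ^+ q}. *)
Definition galois_conjugates (L : finFieldType) (q : nat) (v w : L) : bool :=
  (w == v) || (w == v ^+ q).

(* Here iota is the inclusion of K = F_q in L = F_{q^2}. *)
Definition solutions (K L : finFieldType) (iota : {rmorphism K -> L})
    (q d k : nat) (v : 'I_k -> L) : {set K} :=
  [set x : K | [forall i : 'I_k,
     (iota x - v i) ^+ ((q ^ 2 - 1) %/ d)%N == 1]].

(* Main.v *)
Require Import Defs.
From HB Require Import structures.
From mathcomp Require Import all_boot all_order all_algebra all_field.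
From mathcomp Require Import zify ring.
Set Implicit Arguments.
Unset Strict Implicit.
Unset Printing Implicit Defensive.
Import GRing.Theory Num.Theory.
Import Order.TTheory.
Local Open Scope ring_scope.

(* Expanding the indicator of each condition over the powers of a character
   [chi] of order [d] of [L] reduces the claim to the bound
   [|S| <= (2k-1) sqrt q] for [S = sum_x prod_i chi (x - v_i) ^ a_i], where not
   all [a_i] are divisible by [d].  Setting [Psi g = prod_i chi (g (- v_i)) ^ a_i]
   for monic [g] in [K[X]], [S] is the first coefficient of the L-function
   [sum_g Psi g T ^ deg g].  Evaluation at the [- v_i] is equidistributed on
   polynomials of degree [>= 2k], so this is a polynomial of degree [<= 2k-1].
   Its logarithmic derivative expresses the power sums of its reciprocal roots
   as character sums over the extensions [E] of [K]; for [|E| = q ^ (4t)] these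
   are [O(q ^ (2t))] by Bombieri's version of Stepanov's method.  Hence every
   reciprocal root has modulus at most [sqrt q]. *)

(** The degree [4t] serves three ends. [E] contains [L], so values at the points [- v_i] can be read
    as norms from [E] to [L]. The order of [E] is a square [r ^ 2] with [r = q ^ (2t)] a power of
    the characteristic, as Stepanov's method asks. And [d] divides [r - 1], because it divides
    [q ^ 2 - 1]. These power sums suffice, since bounding the fourth powers of the reciprocal roots
    bounds the roots; the implied constant disappears in the limit provided that it is independent
    of [t]. It is, because the polynomial whose character is summed over [E] has degree
    [(q + 1) * sum a_i]. Stepanov's method bounds only from above the number of points in each of
    the [d] classes of the character. The classes together contain almost all of [E], so the upper
    bounds imply lower ones. The linear independence behind the method needs exponents with no
    factor in common with [d]; a common factor is removed beforehand by passing to a power of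
    [chi]. *)

(** * Kummer polynomials over a function field *)

(* The companion matrix [C] of [p] satisfies [C ^+ d = a], so its determinant
   is the required root. *)
Lemma dvdp_XnsubC_root (F : fieldType) (a : F) (d : nat) (p : {poly F}) :
  p %| 'X^d - a%:P -> (1 < size p)%N -> exists c, c ^+ d = a ^+ (size p).-1.
Proof.
wlog mon_p : p / p \is monic.
  move=> H pd sp; have p0 : p != 0 by rewrite -size_poly_gt0 ltnW.
  have lp : lead_coef p != 0 by rewrite lead_coef_eq0.
  have := H ((lead_coef p)^-1 *: p); rewrite size_scale ?invr_eq0 //.
  by apply=> //; rewrite ?dvdpZl ?invr_eq0 // monicE lead_coefZ mulVf.
move=> pd sp; pose n := (size p).-2.
have sn : size p = n.+2 by rewrite /n; case: (size p) sp => [|[]].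
have hn : (size p).-1 = n.+1 by rewrite sn.
have := companionmxK mon_p; move: (companionmx p); rewrite hn => A chA.
exists (\det A); rewrite -(det_scalar n.+1 a).
have -> : (a%:M : 'M_n.+1) = A ^+ d.
  have := congr1 (horner_mx A) (divpK pd).
  rewrite rmorphM rmorphB rmorphXn /= horner_mx_X horner_mx_C.
  rewrite -{2}chA Cayley_Hamilton mulr0 => /eqP.
  by rewrite eq_sym subr_eq0 => /eqP.
by elim: d {pd} => [|m IHm]; rewrite ?expr0 ?det1 // !exprS -mulmxE det_mulmx IHm.
Qed.

Lemma mupX (R : fieldType) (x : R) (p : {poly R}) n :
  p != 0 -> mup x (p ^+ n) = (n * mup x p)%N.
Proof.
move=> p0; elim: n => [|n IHn]; first by rewrite expr0 mupNroot ?root1.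
by rewrite exprS mupM ?expf_neq0 // IHn mulSn.
Qed.

Lemma mup_prod_XsubCX (R : fieldType) (I : finType) (w : I -> R)
    (b : I -> nat) (i : I) : injective w ->
  mup (w i) (\prod_j ('X - (w j)%:P) ^+ b j) = b i.
Proof.
move=> inj_w; rewrite (bigD1 i) //= mupMl ?mup_XsubCX ?eqxx //.
rewrite rootE horner_prod; apply/prodf_neq0 => j /negPf ji.
by rewrite hornerE hornerXsubC expf_neq0 // subr_eq0 eq_sym inj_eq // ji.
Qed.

Lemma size_sum_leq (R : nzSemiRingType) (I : Type) (r : seq I) (P : pred I)
    (F : I -> {poly R}) n :
  (forall i, P i -> (size (F i) <= n)%N) -> (size (\sum_(i <- r | P i) F i)%R <= n)%N.
Proof. move=> h; apply: leq_trans (size_sum _ _ _) _.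
by elim/big_ind: _ => // x y hx hy; rewrite geq_max hx hy. Qed.

Lemma size_det_leq (R : comNzRingType) n (A : 'M[{poly R}]_n) (s : 'I_n -> nat) :
  (forall i j, (size (A i j) <= (s i).+1)%N) ->
  (size (\det A) <= (\sum_i s i).+1)%N.
Proof.
move=> hA; apply: size_sum_leq => g _.
rewrite -(rmorph_sign (@polyC R)) mul_polyC (leq_trans (size_scale_leq _ _)) //.
apply: leq_trans (size_poly_prod_leq _ _) _.
rewrite leq_subLR addnS ltnS -sum1_card -big_split leq_sum //.
Qed.

Lemma size_resultant_leq (R : comNzRingType) (p q : {poly {poly R}}) (m n : nat) :
  (forall i, (size (p`_i)%R <= m.+1)%N) -> (forall i, (size (q`_i)%R <= n.+1)%N) ->
  (size (resultant p q) <= ((size q).-1 * m + (size p).-1 * n).+1)%N.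
Proof.
move=> hp hq; pose s (i : 'I_((size q).-1 + (size p).-1)) :=
  if split i is inl _ then m else n.
have -> : ((size q).-1 * m + (size p).-1 * n = \sum_i s i)%N.
  rewrite big_split_ord /=; congr addn.
    rewrite (eq_bigr (fun=> m)) ?sum_nat_const ?card_ord // => i _.
    by rewrite /s (unsplitK (inl i)).
  rewrite (eq_bigr (fun=> n)) ?sum_nat_const ?card_ord // => i _.
  by rewrite /s (unsplitK (inr i)).
apply: size_det_leq => i j; rewrite Sylvester_mxE /s.
by case: (split i) => k; case: (k <= j)%N; rewrite /= ?mulr1n ?mulr0n ?size_poly0.
Qed.

Lemma fractionP (R : idomainType) (x : {fraction R}) :
  exists n s : R, s != 0 /\ x * FracField.tofrac s = FracField.tofrac n.
Proof.
elim/quotW: x => x; exists (\n_x), (\d_x); split; first exact: denom_ratioP.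
unlock FracField.tofrac; rewrite -[LHS]FracField.pi_mul /FracField.mulf.
rewrite !numden_Ratio ?oner_eq0 // mulr1; apply/eqmodP.
rewrite /= FracField.equivfE.
by rewrite !numden_Ratio ?mulf_neq0 ?oner_eq0 ?denom_ratioP // mulr1 mulrC.
Qed.

(* A common factor of degree [e < d] would make [(c2 / F1) ^+ e] a [d]-th power;
   comparing multiplicities at each root [w i] of [F1] gives [d %| e]. *)
Lemma resultant_kummer_neq0 (k : fieldType) (I : finType) (w : I -> k)
    (b : I -> nat) (d : nat) (c1 c2 : k) (A : {poly {poly k}}) :
    injective w -> (forall e, (forall i, d %| e * b i) -> d %| e)%N ->
    c1 != 0 -> c2 != 0 -> A != 0 -> (size A <= d)%N ->
  resultant A ((c1 *: \prod_i ('X - (w i)%:P) ^+ b i) *: 'X^d - c2%:P%:P) != 0.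
Proof.
move=> inj_w hb c1n0 c2n0 An0 sA; set F1 := c1 *: _.
pose tf : {rmorphism {poly k} -> {fraction {poly k}}} := @FracField.tofrac {poly k}.
have tf0 x : (tf x == 0) = (x == 0) by apply: tofrac_eq0.
have tf_inj : injective tf by move=> x y /eqP; rewrite tofrac_eq => /eqP.
have P0 : \prod_i ('X - (w i)%:P) ^+ b i != 0.
  by apply/prodf_neq0 => i _; rewrite expf_neq0 // polyXsubC_eq0.
have F10 : F1 != 0 by rewrite scaler_eq0 negb_or c1n0 P0.
have d_gt0 : (0 < d)%N by apply: leq_trans sA; rewrite size_poly_gt0.
set B := _ - _.
have lB : lead_coef B = F1.
  rewrite lead_coefDl; first by rewrite lead_coefZ lead_coefXn mulr1.
  rewrite size_polyN size_scale // size_polyXn ltnS.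
  exact: leq_trans (size_polyC_leq1 _) d_gt0.
(* Over the fraction field a zero resultant means a nontrivial gcd [G], which then divides
   ['X^d - c2 / F1]. *)
rewrite -tf0 map_resultant ?lB ?tf0 ?lead_coef_eq0 // resultant_eq0.
apply/negP; set G := gcdp _ _ => sG.
pose a := tf c2%:P / tf F1.
have GB : G %| 'X^d - a%:P.
  have : G %| map_poly tf B by apply: dvdp_gcdr.
  have -> : map_poly tf B = tf F1 *: ('X^d - a%:P).
    have aE : tf F1 * a = tf c2%:P by rewrite mulrC divfK ?tf0.
    rewrite rmorphB /= map_polyZ map_polyXn map_polyC /= scalerBr -aE.
    by congr (_ - _); rewrite polyCM mul_polyC.
  by rewrite dvdpZr ?tf0.
have [c hc] := dvdp_XnsubC_root GB sG.
have sGd : (size G <= d)%N.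
  apply: leq_trans (leq_trans sA _) => //.
  rewrite -(size_map_poly_id0 (f := tf) (p := A)) ?tf0 ?lead_coef_eq0 //.
  by apply: dvdp_leq; rewrite ?dvdp_gcdl // map_poly_eq0_id0 ?tf0 ?lead_coef_eq0.
have [n [s [s0 ns]]] := fractionP c.
set e := (size G).-1 in hc.
have n0 : n != 0.
  apply/negP => /eqP n0; move: ns; rewrite n0 [RHS](rmorph0 tf) => /eqP.
  rewrite mulf_eq0 tofrac_eq0 (negPf s0) orbF => /eqP c0.
  move/eqP: hc; rewrite c0 expr0n gtn_eqF //= eq_sym expf_eq0 /a mulf_eq0 invr_eq0.
  by rewrite !tf0 polyC_eq0 (negPf c2n0) (negPf F10) andbF.
have key : n ^+ d * F1 ^+ e = s ^+ d * c2%:P ^+ e.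
  apply: tf_inj; rewrite !rmorphM !rmorphXn /= -[FracField.tofrac n]/(tf n).
  rewrite -[tf n]ns exprMn hc -[FracField.tofrac s]/(tf s) /a expr_div_n.
  rewrite -[FracField.tofrac F1]/(tf F1) -[FracField.tofrac c2%:P]/(tf c2%:P).
  rewrite [_ * tf s ^+ d]mulrC -mulrA; congr (_ * _).
  by apply: divfK; rewrite expf_eq0 tf0 (negPf F10) andbF.
have : (d %| e)%N.
  apply: hb => i; have := congr1 (mup (w i)) key.
  rewrite !mupM ?expf_neq0 ?polyC_eq0 // !mupX ?polyC_eq0 // /F1 -mul_polyC.
  rewrite mupM ?polyC_eq0 // !(mupNroot (q := _%:P)) ?rootC // mup_prod_XsubCX //.
  rewrite muln0 addn0 add0n => /eqP; rewrite eq_sym => /eqP h.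
  by rewrite -(dvdn_addr (e * b i) (dvdn_mulr (mup (w i) n) (dvdnn d))) -h dvdn_mulr.
have e_gt0 : (0 < e)%N by rewrite /e -subn1 subn_gt0.
rewrite gtnNdvd //; move: sGd e_gt0; rewrite /e; case: (size G) => //.
Qed.

Lemma exprBn_pchar (R : comNzRingType) (x y : R) n :
  [pchar R].-nat n -> (x - y) ^+ n = x ^+ n - y ^+ n.
Proof.
move=> hn; apply/eqP; rewrite -subr_eq0 opprB addrA subr_eq0 -exprDn_pchar //.
by rewrite subrK.
Qed.

(* [evz r H] substitutes [z := X ^ r] in a polynomial [H] in [X] with
   coefficients in [E[z]]. *)
Definition evz (E : fieldType) r (H : {poly {poly E}}) : {poly E} :=
  (map_poly (comp_poly 'X^r) H).['X].

Section Evz.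
Variables (E : fieldType) (r : nat).

Lemma evz_is_zmod_morphism : zmod_morphism (@evz E r).
Proof. by move=> p q; rewrite /evz rmorphB hornerD hornerN. Qed.
HB.instance Definition _ :=
  GRing.isZmodMorphism.Build _ _ (@evz E r) evz_is_zmod_morphism.
Lemma evz_is_monoid_morphism : monoid_morphism (@evz E r).
Proof.
by split=> [|p q]; rewrite /evz ?rmorph1 ?hornerC // rmorphM hornerM.
Qed.
HB.instance Definition _ :=
  GRing.isMonoidMorphism.Build _ _ (@evz E r) evz_is_monoid_morphism.

Lemma evzC (p : {poly E}) : evz r p%:P = p \Po 'X^r.
Proof. by rewrite /evz map_polyC hornerC. Qed.

Lemma evz_polyC (p : {poly E}) : evz r p^:P = p.
Proof.
rewrite /evz -map_poly_comp -[RHS]comp_polyXr /comp_poly; congr (_.[_]).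
by apply: eq_map_poly => x /=; rewrite comp_polyC.
Qed.

(** Base-[r] digits: the coefficient of [evz r H] at index [r * j + s] with [s < r] comes from the
    single term ['X^s z^j] of [H], so nothing can cancel. *)
Lemma evz_eq0 (H : {poly {poly E}}) : (size H <= r)%N -> evz r H = 0 -> H = 0.
Proof.
case: r => [|r'] in H *; first by rewrite leqn0 size_poly_eq0 => /eqP.
set n := r'.+1 => sH H0; apply/polyP => s; apply/polyP => j; rewrite !coef0.
have [sr|rs] := ltnP s n; last first.
  by rewrite [H`_s]nth_default ?coef0 //; apply: leq_trans sH rs.
have := congr1 (fun p : {poly E} => p`_(n * j + s)) H0.
rewrite /evz (@horner_coef_wide _ n); last exact: leq_trans (size_poly _ _) sH.
rewrite coef0 coef_sum (bigD1 (Ordinal sr)) //= big1 ?addr0 => [|[t tn] /=].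
  rewrite coef_map_id0 ?comp_poly0 // coefMXn ltnNge leq_addl /= addnK.
  by rewrite coef_comp_poly_Xn // dvdn_mulr // mulKn.
rewrite -val_eqE /= => ts; rewrite coef_map_id0 ?comp_poly0 // coefMXn.
case: ltnP => // tle; rewrite coef_comp_poly_Xn //; case: ifP => // hd.
case/negP: ts; rewrite -(modn_small tn) -(modn_small sr) eq_sym.
by rewrite -(eqn_mod_dvd _ tle) [(n * j)%N]mulnC modnMDl in hd.
Qed.

End Evz.

Lemma size_prod_XsubCX (R : idomainType) (I : finType) (w : I -> R) (b : I -> nat) :
  size (\prod_i ('X - (w i)%:P) ^+ b i) = (\sum_i b i).+1.
Proof.
rewrite size_prod => [|i _]; last by rewrite expf_neq0 // polyXsubC_eq0.
rewrite (eq_bigr (fun i => b i + 1)%N) => [|i _]; last by rewrite size_exp_XsubC addn1.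
by rewrite big_split /= sum1_card -addSn addnK.
Qed.

(** Read the [H i] as the coefficients of a polynomial [A] of degree less than [d] in a new variable
    [Y], and let [B] be [f Y^d - c2(z)], where [c2('X^r) = f ^+ r] by Frobenius. After [z := 'X^r]
    both vanish at [Y = f ^+ u], the second since [r = d * u + 1], so [evz r] kills their resultant.
    Its degree in ['X] is at most [d * delta + d.-1 * m < r], so [evz_eq0] would make it zero,
    against [resultant_kummer_neq0]. *)
Lemma kummer_indep (E : fieldType) (I : finType) (w : I -> E) (b : I -> nat)
    (c : E) (d u r delta : nat) (H : 'I_d -> {poly {poly E}}) :
    let f := c *: \prod_i ('X - (w i)%:P) ^+ b i in
    let m := (\sum_i b i)%N in
    [pchar E].-nat r -> r = (d * u).+1 ->
    injective w -> (forall e, (forall i, d %| e * b i) -> d %| e)%N -> c != 0 ->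
    (d * delta + d.-1 * m < r)%N ->
    (forall i, (size (H i) <= delta.+1)%N) ->
    \sum_i evz r (H i) * f ^+ (u * i) = 0 ->
  forall i, H i = 0.
Proof.
move=> f m hr hru inj_w hb c0 hdr sH H0.
pose A := \poly_(j < d) (if insub j is Some i then H i else 0).
have AE (i : 'I_d) : A`_i = H i by rewrite coef_poly ltn_ord valK.
have sA : (size A <= d)%N by apply: size_poly.
suff A0 : A = 0 by move=> i; rewrite -AE A0 coef0.
apply/eqP/negPn/negP => An0.
have d_gt0 : (0 < d)%N by apply: leq_trans sA; rewrite size_poly_gt0.
pose c2 := c ^+ r *: \prod_i ('X - (w i ^+ r)%:P) ^+ b i.
have c20 : c2 != 0.
  rewrite scaler_eq0 expf_eq0 (negPf c0) andbF /=.
  by apply/prodf_neq0 => i _; rewrite expf_neq0 // polyXsubC_eq0.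
have c2E : c2 \Po 'X^r = f ^+ r.
  rewrite comp_polyZ exprZn; congr (_ *: _).
  rewrite rmorph_prod /= -prodrXl; apply: eq_bigr => i _.
  rewrite rmorphXn /= comp_polyB comp_polyX comp_polyC polyC_exp exprAC.
  by rewrite [in RHS]exprBn_pchar // (eq_pnat _ (@pchar_poly E)).
pose B := (f^:P) *: 'X^d - c2%:P%:P.
pose tf : {rmorphism {poly E} -> {fraction {poly E}}} := @FracField.tofrac {poly E}.
pose tfm : {rmorphism {poly {poly E}} -> {poly {fraction {poly E}}}} := map_poly tf.
have tf0 x : (tf x == 0) = (x == 0) by apply: tofrac_eq0.
have tf_inj : injective tf by move=> x y /eqP; rewrite tofrac_eq => /eqP.
have tfm0 x : (tfm x == 0) = (x == 0).
  have [->|x0] := eqVneq x 0; first by rewrite rmorph0 eqxx.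
  by rewrite map_poly_eq0_id0 ?(negPf x0) // tf0 lead_coef_eq0.
have f0 : f != 0.
  rewrite scaler_eq0 (negPf c0) /=.
  by apply/prodf_neq0 => i _; rewrite expf_neq0 // polyXsubC_eq0.
have fP0 : f^:P != 0 by rewrite map_polyC_eq0.
have sB' : (size (- c2%:P%:P : {poly {poly {poly E}}}) < size (f^:P *: 'X^d)%R)%N.
  rewrite size_polyN size_scale // size_polyXn ltnS.
  exact: leq_trans (size_polyC_leq1 _) d_gt0.
have lB : lead_coef B = f^:P.
  by rewrite lead_coefDl // lead_coefZ lead_coefXn mulr1.
have sB : size B = d.+1.
  by rewrite size_polyDl // size_scale // size_polyXn.
have res0 : resultant A B != 0.
  rewrite -tfm0 map_resultant ?lB ?tfm0 ?lead_coef_eq0 //.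
  pose c1' := tf c%:P; pose w' i := tf (w i)%:P.
  have -> : map_poly tfm B =
      (c1' *: \prod_i ('X - (w' i)%:P) ^+ b i) *: 'X^d - (tf c2)%:P%:P.
    rewrite rmorphB /= map_polyZ map_polyXn map_polyC /= map_polyC /=.
    congr (_ *: _ - _); rewrite /tfm /f /= !map_polyZ /= !rmorph_prod.
    congr (_ *: _); apply: eq_bigr => i _.
    by rewrite !rmorphXn !rmorphB /= !map_polyX !map_polyC.
  apply: resultant_kummer_neq0 => //.
  - by move=> i j /tf_inj /polyC_inj /inj_w.
  - by rewrite tf0 polyC_eq0.
  - by rewrite tf0.
  - by rewrite map_poly_eq0_id0 // tfm0 lead_coef_eq0.
  - by apply: leq_trans (size_poly _ _) sA.
case/negP: res0; apply/eqP.
have hf : map_poly (evz r) A = \sum_(i < d) (evz r (H i))%:P * 'X^i.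
  rewrite /A poly_def rmorph_sum; apply: eq_bigr => i _.
  by rewrite /= map_polyZ map_polyXn valK mul_polyC.
have rootA : (map_poly (evz r) A).[f ^+ u] = 0.
  rewrite hf horner_sum -[RHS]H0; apply: eq_bigr => i _.
  by rewrite hornerM hornerC hornerXn exprM.
have rootB : (map_poly (evz r) B).[f ^+ u] = 0.
  rewrite rmorphB /= map_polyZ map_polyXn map_polyC /= evzC evz_polyC c2E.
  by rewrite hornerD hornerN hornerC hornerZ hornerXn -exprM -exprS mulnC -hru subrr.
have [sA1|sA1] := leqP (size A) 1.
  have A0 : A = (A`_0)%:P by apply: size1_polyC.
  case/eqP: An0; rewrite A0; congr _%:P; apply: (@evz_eq0 _ r).
    rewrite -[0%N]/(nat_of_ord (Ordinal d_gt0)) AE (leq_trans (sH _)) //.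
    by apply: leq_trans hdr; rewrite ltnS (leq_trans _ (leq_addr _ _)) // leq_pmull.
  by move: rootA; rewrite A0 map_polyC hornerC coefC.
have sB1 : (1 < size B)%N by rewrite sB.
apply: (@evz_eq0 _ r).
  apply: leq_trans (@size_resultant_leq _ A B delta m _ _) _.
  - move=> i; rewrite coef_poly; case: ifP => // hi; last by rewrite size_poly0.
    by case: insubP => [j _ _|]; rewrite ?size_poly0.
  - move=> i; rewrite coefB coefZ coefXn coefC.
    apply: leq_trans (size_polyD _ _) _; rewrite geq_max size_polyN; apply/andP; split.
      case: (i == d); rewrite ?mulr1 ?mulr0 ?size_poly0 // size_map_polyC.
      by rewrite size_scale // size_prod_XsubCX.
    by case: (i == 0%N); rewrite ?size_poly0 // (leq_trans (size_polyC_leq1 _)).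
  rewrite sB /=; apply: leq_trans hdr; rewrite !ltnS leq_add2l leq_mul2r.
  by rewrite -!subn1 leq_sub2r ?orbT.
have [[U V] /= _ resE] := resultant_in_ideal sA1 sB1.
have := congr1 (fun p => (map_poly (evz r) p).[f ^+ u]) resE.
by rewrite map_polyC hornerC rmorphD !rmorphM hornerD !hornerM rootA rootB !mulr0 addr0.
Qed.

(** * Stepanov's method *)

Lemma expr_sum_pchar (R : comNzRingType) (I : Type) (s : seq I) (F : I -> R) n :
  [pchar R].-nat n -> (\sum_(i <- s) F i) ^+ n = \sum_(i <- s) F i ^+ n.
Proof.
move=> hn; elim/big_rec2: _ => [|i x y _ <-]; last by rewrite exprDn_pchar.
by have /andP[n0 _] := hn; rewrite expr0n gtn_eqF.
Qed.

Lemma poly_lin_dep (E : fieldType) (I : finType) (P : I -> {poly E}) (s : nat) :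
  (forall i, (size (P i) <= s)%N) -> (s < #|I|)%N ->
  exists2 a : I -> E, exists i, a i != 0 & \sum_i a i *: P i = 0.
Proof.
move=> sP sI; pose A := \matrix_(i < #|I|, j < s) (P (enum_val i))`_j.
have : kermx A != 0.
  rewrite -mxrank_eq0 mxrank_ker subn_eq0 -ltnNge.
  exact: leq_ltn_trans (rank_leq_col A) sI.
case/rowV0Pn => v /sub_kermxP vA v0.
exists (fun i => v 0 (enum_rank i)).
  have [i vi] : exists i, v 0 i != 0.
    apply/existsP; apply: contraNT v0; rewrite negb_exists => /forallP h.
    by apply/eqP/rowP => i; rewrite mxE; apply/eqP/negPn/h.
  by exists (enum_val i); rewrite enum_valK.
apply/polyP => j; rewrite coef0 coef_sum.
have [js|sj] := ltnP j s; last first.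
  by apply: big1 => i _; rewrite coefZ nth_default ?mulr0 // (leq_trans (sP _)).
have /matrixP/(_ 0 (Ordinal js)) := vA; rewrite !mxE => hj; rewrite -[RHS]hj.
rewrite (reindex (@enum_val I predT)) /=; last exact/onW_bij/enum_val_bij.
by apply: eq_bigr => i _; rewrite coefZ enum_valK !mxE.
Qed.

(* Bombieri's variant of Stepanov's method: the auxiliary polynomial [S] is
   chosen so that [S ^+ r * g ^+ d.-1] agrees, at the points counted, with a
   polynomial of small degree whose coefficients can be made to vanish. *)
Lemma stepanov (E : finFieldType) (I : finType) (w : I -> E) (b : I -> nat)
    (c z : E) (d u r : nat) :
    let f := c *: \prod_i ('X - (w i)%:P) ^+ b i in
    let m := (\sum_i b i)%N in
    [pchar E].-nat r -> #|E| = (r ^ 2)%N -> r = (d * u).+1 ->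
    injective w -> (forall e, (forall i, d %| e * b i) -> d %| e)%N ->
    c != 0 -> z != 0 -> (1 < d)%N -> (1 < u)%N -> (2 * m <= u)%N ->
  (d * #|[set x : E | f.[x] ^+ (u * r.+1) == z]| <= r ^ 2 + (3 * d * m + 1) * r)%N.
Proof.
move=> f m hr cE hru inj_w hb c0 z0 d1 u1 mu.
have r0 : (0 < r)%N by rewrite hru.
(* The index [(i, (j, l))] stands for the term ['X^(r * j + l) * g ^+ i] of [S]. The range
   [l <= u - m] gives [d * (u - m) + d.-1 * m < r], as [kummer_indep] requires; the range of [j] is
   widened by [2 * m] so that the unknowns outnumber the equations. *)
pose T : finType := ('I_d * ('I_(u + 2 * m).+1 * 'I_(u - m).+1))%type.
pose g := f ^+ u.
have sf : size f = m.+1 by rewrite size_scale // size_prod_XsubCX.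
have f0 : f != 0 by rewrite -size_poly_gt0 sf.
have sg n : size (g ^+ n) = (m * u * n).+1.
  have := size_exp f (u * n); rewrite sf /= -exprM => h.
  by rewrite -mulnA -h prednK // size_poly_gt0 expf_neq0.
(* [P i] is what the term [i] of [S] becomes in [S ^+ r * g ^+ d.-1] at a counted point: there
   [x ^+ (r ^ 2) = x] turns ['X^(r * (r * j + l))] into ['X^(r * l + j)], and [g.[x] ^+ r.+1 = z]
   turns [g ^+ (r * i + d.-1)] into [z ^+ i *: g ^+ (d.-1 - i)]. *)
pose P (i : 'I_d * ('I_(u + 2 * m).+1 * 'I_(u - m).+1)) :=
  z ^+ i.1 *: ('X^(r * i.2.2 + i.2.1) * g ^+ (d.-1 - i.1)).
pose s := (r * (u - m) + (u + 2 * m) + m * u * d.-1).+1.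
have sP i : (size (P i) <= s)%N.
  apply: leq_trans (size_scale_leq _ _) _.
  apply: leq_trans (size_polyMleq _ _) _; rewrite size_polyXn sg /s /= addnS /= ltnS.
  rewrite !leq_add ?leq_mul ?leq_subr //; first by rewrite -ltnS ltn_ord.
  by rewrite -ltnS ltn_ord.
have cT : (s < #|T|)%N.
  rewrite /T !card_prod !card_ord /s; have := d1; have := hru.
  case: (d) => // e; rewrite /= => -> e1.
  have [t ut] : exists t, u = (2 * m + t)%N by exists (u - 2 * m)%N; rewrite subnKC.
  have [v vE] : exists v, v = (u - m)%N by exists (u - m)%N.
  have vmt : v = (m + t)%N by rewrite vE ut; lia.
  rewrite -vE.
  have h1 : (m * u * e <= m * (2 * v) * e.+1)%N.
    by rewrite leq_mul // leq_mul2l vmt ut mulnDr leq_add2l leq_pmull ?orbT.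
  have h2 : (u + 2 * m <= 2 * u)%N by rewrite [leqRHS]mul2n -addnn leq_add2l.
  have h3 : (2 * u <= e.+1 * u)%N by apply: leq_mul.
  have h4 : (2 * v.+1 <= e.+1 * v.+1)%N by apply: leq_mul.
  have -> : (e.+1 * ((u + 2 * m).+1 * v.+1) = e.+1 * u * v + e.+1 * u +
    m * (2 * v) * e.+1 + e.+1 * m * 2 + e.+1 * v.+1)%N by ring.
  rewrite mulSn; apply: (@leq_trans (e.+1 * u * v + 2 * u + m * u * e + 2 * v.+1)).
    lia.
  apply: (leq_add _ h4).
  exact: (leq_trans (leq_add (leq_add (leqnn _) h3) h1) (leq_addr _ _)).
have [a [i0 ai0] aP] := poly_lin_dep sP cT.
(* The coefficients are [r]-th powers because [a ^+ (r ^ 2) = a] in [E]: those of [S ^+ r] are then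
   the [a i] of the linear dependence. *)
pose S := \sum_i a i ^+ r *: ('X^(r * i.2.1 + i.2.2) * g ^+ i.1).
pose a' (i : 'I_d) j l := a (i, (inord j, inord l)) ^+ r.
pose H (i : 'I_d) := \poly_(l < (u - m).+1) \poly_(j < (u + 2 * m).+1) a' i j l.
have SE : S = \sum_i evz r (H i) * f ^+ (u * i).
  pose F (i : 'I_d) (j : 'I_(u + 2 * m).+1) (l : 'I_(u - m).+1) :=
    a (i, (j, l)) ^+ r *: ('X^(r * j + l) * g ^+ i).
  transitivity (\sum_i \sum_j \sum_l F i j l).
    under [RHS]eq_bigr => i _ do rewrite pair_bigA.
    by rewrite pair_bigA; apply: eq_bigr => -[i [j l]].
  apply: eq_bigr => i _; rewrite exprM -/g /H poly_def rmorph_sum /= big_distrl /=.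
  rewrite exchange_big; apply: eq_bigr => l _ /=.
  rewrite poly_def -mul_polyC rmorphM /= evzC rmorph_sum /= rmorphXn /=.
  have -> : evz r 'X = 'X :> {poly E} by rewrite -(map_polyX (@polyC E)) evz_polyC.
  rewrite -mulrA big_distrl /=; apply: eq_bigr => j _.
  rewrite comp_polyZ rmorphXn /= comp_polyX -exprM /F exprD /a' !inord_val.
  by rewrite -mulrA scalerAl.
have S0 : S != 0.
  apply/negP => /eqP; rewrite SE => /(kummer_indep hr hru inj_w hb c0) h.
  have {}h i : H i = 0.
    apply: (h (u - m)%N) => [|j]; last exact: size_poly.
    rewrite hru ltnS mulnBr -subn1 mulnBl mul1n.
    have := leq_mul2l d m u; lia.
  have := congr1 (fun p : {poly {poly E}} => (p`_i0.2.2)`_i0.2.1) (h i0.1).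
  rewrite /= !coef0 !coef_poly !ltn_ord /= coef_poly ltn_ord /a' !inord_val.
  case: i0 ai0 => i [j l] /= /negPf ai0 /eqP.
  by rewrite expf_eq0 ai0 andbF.
have rootS x : f.[x] ^+ (u * r.+1) == z -> root S x.
  move/eqP; rewrite exprM -horner_exp -/g => gxz.
  have gx0 : g.[x] != 0.
    by apply: contraNneq z0 => gx; rewrite -gxz gx expr0n.
  suff : S.[x] ^+ r * g.[x] ^+ d.-1 == 0.
    by rewrite mulf_eq0 !expf_eq0 (negPf gx0) andbF orbF => /andP[].
  have := congr1 (horner^~ x) aP; rewrite horner0 => <-.
  rewrite /S !horner_sum expr_sum_pchar // big_distrl /=; apply/eqP.
  apply: eq_bigr => -[i [j l]] _; rewrite /P /= !hornerZ !hornerM !hornerXn.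
  have gE n : (g ^+ n).[x] = g.[x] ^+ n by apply: horner_exp.
  rewrite !gE; move: g.[x] gxz gx0 => y yz y0; rewrite !exprMn -!exprM.
  have ie : (i <= d.-1)%N by rewrite -ltnS prednK // ltnW.
  have xE n : x ^+ (n * (r * r)) = x ^+ n by rewrite mulnn -cE mulnC exprM expf_card.
  have aE t : t ^+ (r * r) = t :> E by rewrite mulnn -cE expf_card.
  rewrite aE -!mulrA; congr (_ * _); rewrite [in RHS]mulrCA -yz -exprM.
  have -> : ((r * j + l) * r = j * (r * r) + l * r)%N by ring.
  rewrite exprD xE -exprD [(l * r)%N]mulnC [(j + _)%N]addnC; congr (_ * _).
  by rewrite -!exprD; congr (_ ^+ _); rewrite -{1}(subnK ie); ring.
pose X := [set x : E | f.[x] ^+ (u * r.+1) == z].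
have NS : (#|X| < size S)%N.
  rewrite cardE; apply: max_poly_roots => //; last exact: enum_uniq.
  by apply/allP => x; rewrite mem_enum inE; apply: rootS.
have sS : (size S <= (r * (u + 2 * m) + (u - m) + m * u * d.-1).+1)%N.
  apply: size_sum_leq => i _; apply: leq_trans (size_scale_leq _ _) _.
  apply: leq_trans (size_polyMleq _ _) _; rewrite size_polyXn sg addnS /= ltnS.
  rewrite !leq_add ?leq_mul ?leq_subr //; first by rewrite -ltnS ltn_ord.
    by rewrite -ltnS ltn_ord.
  by rewrite -ltnS prednK ?ltn_ord // ltnW.
have {NS} : (#|X| <= r * (u + 2 * m) + (u - m) + m * u * d.-1)%N.
  by rewrite -ltnS; apply: leq_trans NS sS.
rewrite -/X; move: #|X| => N hN.
have h1 : (d * N <= d * u * r + 2 * d * m * r + d * u + d * u * (d * m))%N.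
  apply: leq_trans (leq_mul (leqnn d) hN) _.
  have -> : (d * u * r + 2 * d * m * r = d * (r * (u + 2 * m)))%N by ring.
  have -> : (d * u * (d * m) = d * (m * u * d))%N by ring.
  by rewrite !mulnDr !leq_add // leq_mul2l ?leq_subr ?leq_mul2l ?leq_pred ?orbT.
apply: leq_trans h1 _.
have [r' rE] : exists r', r = r'.+1 by exists (d * u)%N.
have -> : (d * u = r')%N by apply: succn_inj; rewrite -hru.
have -> : (3 * d * m = 3 * (d * m))%N by ring.
have -> : (2 * d * m = 2 * (d * m))%N by ring.
have -> : (r ^ 2 + (3 * (d * m) + 1) * r =
  r' * r + 2 * (d * m) * r + r' + r' * (d * m) + (r' + 2 + d * m))%N by rewrite rE; ring.
exact: leq_addr.
Qed.

(** * Newton identities and growth of power sums *)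

Section PowerSums.
Variable C : numClosedFieldType.
Implicit Types s : seq C.

Definition psum s n : C := \sum_(a <- s) a ^+ n.

(** Induction on the list: multiplying the product by [1 - a *: 'X] brings in a sum over powers of
    [a] that telescopes to one term ([tel]). *)
Lemma newton_identity s n :
  n%:R * (\prod_(a <- s) (1 - a *: 'X))`_n =
  - \sum_(j < n) (\prod_(a <- s) (1 - a *: 'X))`_(n - j.+1) * psum s j.+1.
Proof.
elim: s n => [|a s IHs] n.
  rewrite big_nil coef1 big1 ?oppr0 => [|j _]; last by rewrite /psum big_nil mulr0.
  by case: n => [|n]; rewrite ?mul0r ?mulr0.
case: n => [|n]; first by rewrite big_ord0 mul0r oppr0.
rewrite !big_cons; set p := \prod_(b <- s) _ in IHs *.
have coE k : ((1 - a *: 'X) * p)`_k = p`_k - a * (if k is k'.+1 then p`_k' else 0).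
  rewrite mulrBl mul1r coefB -scalerAl coefZ coefXM.
  by case: k.
have psE k : psum (a :: s) k = a ^+ k + psum s k by rewrite /psum big_cons.
under eq_bigr => j _ do rewrite psE mulrDr.
rewrite big_split /= coE mulrBr IHs.
have tel : \sum_(j < n.+1) ((1 - a *: 'X) * p)`_(n.+1 - j.+1) * a ^+ j.+1 = a * p`_n.
  have {}coE j : (j < n.+1)%N -> ((1 - a *: 'X) * p)`_(n.+1 - j.+1) * a ^+ j.+1 =
    p`_(n - j) * a ^+ j.+1 - (if (j < n)%N then p`_(n - j.+1) * a ^+ j.+2 else 0).
    move=> jn; rewrite coE subSS mulrBl; congr (_ - _).
    case: ltnP => jn'; last first.
      have -> : (n - j = 0)%N by apply/eqP; rewrite subn_eq0.
      by rewrite mulr0 mul0r.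
    by rewrite -(subnSK jn') [in RHS]exprS; ring.
  under eq_bigr => j _ do rewrite (coE j (ltn_ord j)).
  rewrite sumrB.
  rewrite big_ord_recl [X in _ - X]big_ord_recr /= ltnn addr0 subn0 expr1.
  rewrite -addrA -sumrB big1 ?addr0 1?mulrC // => j _.
  by rewrite ltn_ord /bump /= add1n subrr.
rewrite tel.
have -> : \sum_(j < n.+1) ((1 - a *: 'X) * p)`_(n.+1 - j.+1) * psum s j.+1 =
    \sum_(j < n.+1) p`_(n.+1 - j.+1) * psum s j.+1 -
    a * \sum_(j < n) p`_(n - j.+1) * psum s j.+1.
  under eq_bigr => j _ do rewrite coE mulrBl.
  rewrite sumrB; congr (_ - _).
  rewrite big_ord_recr /= subnn mulr0 mul0r addr0 mulr_sumr.
  by apply: eq_bigr => j _; rewrite subSS -(subnSK (ltn_ord j)) mulrA.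
have := IHs n; rewrite -[n.+1%:R]natr1 => h.
rewrite mulrCA mulrDl mul1r h; ring.
Qed.

End PowerSums.

Lemma expr_unbounded (x B : algC) :
  1 < x -> (forall t, (0 < t)%N -> x ^+ t <= B) -> False.
Proof.
move=> x1 hB; have B0 : 0 <= B.
  by apply: le_trans (hB 1%N isT); rewrite expr1 ltW // (lt_trans ltr01).
have y0 : 0 < x - 1 by rewrite subr_gt0.
have bern t : 1 + t%:R * (x - 1) <= x ^+ t.
  elim: t => [|t IHt]; first by rewrite mul0r addr0.
  rewrite exprS; apply: le_trans (ler_wpM2l _ IHt); last by rewrite ltW // (lt_trans ltr01).
  rewrite -subr_ge0; have -> : x * (1 + t%:R * (x - 1)) - (1 + t.+1%:R * (x - 1)) =
    t%:R * (x - 1) ^+ 2 by rewrite -natr1; ring.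
  by rewrite mulr_ge0 ?exprn_ge0 // ltW.
pose n := Num.bound (B / (x - 1)).
have hn : B / (x - 1) < n%:R by apply: archi_boundP; rewrite divr_ge0 // ltW.
have := le_trans (bern n.+1) (hB n.+1 isT); apply/negP; rewrite lt_geF //.
rewrite ltr_pdivrMr // in hn; apply: lt_trans hn _.
by rewrite -natr1 mulrDl mul1r addrCA ltrDl addr_gt0 // ltr01.
Qed.

(* The operator [prod_(g != b) (shift - g)] isolates the powers of [b]. *)
Lemma psum_growth (s : seq algC) (B rho : algC) : 0 < rho ->
  (forall t, (0 < t)%N -> `|psum s t| <= B * rho ^+ t) ->
  forall b, b \in s -> `|b| <= rho.
Proof.
move=> rho0 hB b bs; rewrite real_leNgt ?realE ?normr_ge0 ?(ltW rho0) //.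
apply/negP => hb.
pose G := \prod_(g <- undup s | g != b) ('X - g%:P).
have Gs g : g \in s -> g != b -> G.[g] = 0.
  move=> gs gb; rewrite horner_prod; apply/eqP; rewrite prodf_seq_eq0.
  by apply/hasP; exists g; rewrite ?mem_undup // gb hornerXsubC subrr eqxx.
have Gb : G.[b] != 0.
  rewrite horner_prod prodf_seq_neq0; apply/allP => g _.
  by apply/implyP => gb; rewrite hornerXsubC subr_eq0 eq_sym.
have key t : \sum_(l < size G) G`_l * psum s (t + l) = (count_mem b s)%:R * (b ^+ t * G.[b]).
  rewrite /psum; under eq_bigr => l _ do rewrite mulr_sumr.
  rewrite exchange_big /=.
  transitivity (\sum_(a <- s) a ^+ t * G.[a]).
    apply: eq_bigr => a _; rewrite horner_coef mulr_sumr.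
    by apply: eq_bigr => l _; rewrite exprD mulrCA.
  rewrite (bigID (pred1 b)) /= [X in _ + X]big1_seq ?addr0; last first.
    by move=> a /andP[ab as_]; rewrite Gs // mulr0.
  rewrite (eq_bigr (fun=> b ^+ t * G.[b])) => [|a /eqP-> //].
  by rewrite big_const_seq iter_addr_0 mulr_natl.
pose K := (count_mem b s)%:R * `|G.[b]|.
have K0 : 0 < K.
  by rewrite mulr_gt0 ?normr_gt0 // ltr0n -has_count has_pred1.
pose B' := (\sum_(l < size G) `|G`_l| * (B * rho ^+ l)).
apply: (@expr_unbounded (`|b| / rho) (B' / K)); first by rewrite ltr_pdivlMr // mul1r.
move=> t t0; rewrite ler_pdivlMr // expr_div_n mulrAC ler_pdivrMr ?exprn_gt0 //.
have -> : `|b| ^+ t * K = `|\sum_(l < size G) G`_l * psum s (t + l)|.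
  by rewrite key !normrM normrX normr_nat /K mulrCA.
apply: le_trans (ler_norm_sum _ _ _) _; rewrite mulr_suml ler_sum // => l _.
rewrite normrM -!mulrA ler_wpM2l // (le_trans (hB _ _)) ?addn_gt0 ?t0 //.
by rewrite exprD [rho ^+ l * _]mulrC.
Qed.

(** [c] and [s] are the coefficients of a polynomial [L] with [L(0) = 1] and of [T L' / L], so [s n]
    is minus the [n]-th power sum of the at most [D] reciprocal roots. Applying [psum_growth] to
    their [e]-th powers makes bounds along the multiples of [e] enough, and [c 1] is minus the sum
    of these roots. *)
Lemma first_coef_bound (c s : nat -> algC) (D e : nat) (B rho : algC) :
  0 < rho -> (0 < e)%N -> c 0%N = 1 -> (forall n, (D < n)%N -> c n = 0) ->
  (forall n, n%:R * c n = \sum_(j < n) c (n - j.+1)%N * s j.+1) ->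
  (forall t, (0 < t)%N -> `|s (e * t)%N| <= B * rho ^+ (e * t)) ->
  `|c 1%N| <= D%:R * rho.
Proof.
move=> rho0 e0 c0 cD rec hs.
pose L := \poly_(n < D.+1) c n.
have LE n : L`_n = c n by rewrite coef_poly; case: ltnP => // /cD.
have [r Lr] := closed_field_poly_normal L.
have L0 : L != 0.
  by apply: contraTneq (oner_neq0 algC) => L0; rewrite -c0 -LE L0 coef0 eqxx.
have r0 z : z \in r -> z != 0.
  move=> zr; apply: contraTneq (oner_neq0 algC) => z0; rewrite -c0 -LE negbK.
  have : root L 0 by rewrite Lr rootZ ?lead_coef_eq0 // root_prod_XsubC -z0.
  by rewrite rootE horner_coef0.
pose a := [seq z^-1 | z <- r].
have La : L = \prod_(x <- a) (1 - x *: 'X).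
  have h : \prod_(z <- r) ('X - z%:P) =
      (\prod_(z <- r) (- z)) *: \prod_(x <- a) (1 - x *: 'X).
    rewrite /a big_map; elim: (r) r0 => [|z r' IHr] hr; first by rewrite !big_nil scale1r.
    rewrite !big_cons IHr => [|y yr]; last by rewrite hr // inE yr orbT.
    have -> : 'X - z%:P = - z *: (1 - z^-1 *: 'X).
      rewrite scalerBr !scaleNr scalerA divff ?hr ?inE ?eqxx // scale1r opprK.
      by rewrite alg_polyC addrC.
    by rewrite -scalerAl -scalerAr scalerA.
  suff k1 : lead_coef L * \prod_(z <- r) - z = 1 by rewrite Lr h scalerA k1 scale1r.
  have P0 : (\prod_(x <- a) (1 - x *: 'X))`_0 = 1.
    rewrite -horner_coef0 horner_prod big1 // => x _.
    by rewrite hornerD hornerN hornerZ hornerX hornerC mulr0 subr0.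
  by rewrite -[RHS]c0 -LE {2}Lr h scalerA coefZ P0 mulr1.
have sa : (size a <= D)%N.
  have := congr1 (fun p : {poly algC} => size p) Lr.
  rewrite size_scale ?lead_coef_eq0 // size_prod_XsubC size_map -ltnS => <-.
  exact: size_poly.
have sE n : (0 < n)%N -> s n = - psum a n.
  elim/ltn_ind: n => -[//|n] IHn _.
  have := newton_identity a n.+1; rewrite -La LE rec => /eqP.
  rewrite -subr_eq0 opprK -big_split /=.
  rewrite big_ord_recr /= big1 => [|j _]; last first.
    by rewrite LE IHn ?ltnS // mulrN addNr.
  by rewrite add0r subnn LE c0 !mul1r addr_eq0 => /eqP.
have ab x : x \in a -> `|x| <= rho.
  move=> xa; rewrite -(@ler_pXn2r _ e) ?nnegrE ?(ltW rho0) // -normrX.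
  apply: (@psum_growth [seq y ^+ e | y <- a] B) => [|t t0|]; first exact: exprn_gt0.
    rewrite -exprM; apply: le_trans (hs t t0); rewrite sE ?muln_gt0 ?e0 // normrN.
    by rewrite /psum big_map; under eq_bigr => y _ do rewrite -exprM.
  exact: map_f.
have := rec 1%N; rewrite big_ord1 mul1r c0 mul1r => ->.
rewrite sE // normrN /psum; under eq_bigr => x _ do rewrite expr1.
apply: le_trans (ler_norm_sum _ _ _) _.
apply: (@le_trans _ _ (\sum_(x <- a) rho)).
  by rewrite big_seq [leRHS]big_seq ler_sum.
by rewrite big_const_seq count_predT iter_addr_0 mulr_natl ler_wpMn2l // ltW.
Qed.

(** * Irreducible polynomials over a finite field *)

Section Monics.
Variable K : finFieldType.
Implicit Types (g h P : {poly K}) (n e : nat).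

(** The lower part [p] ranges over the additive group [{poly_n K}], so a sum over monic polynomials
    can be translated by any polynomial of degree less than [n]. *)
Definition monics n : seq {poly K} := [seq 'X^n + val p | p : {poly_n K}].

Lemma mem_monics n g : (g \in monics n) = (g \is monic) && (size g == n.+1).
Proof.
apply/imageP/andP => [[p _ ->]|[mg /eqP sg]].
  have h : (size (val p) < size ('X^n : {poly K})%R)%N by rewrite size_polyXn ltnS size_npoly.
  by rewrite monicE lead_coefDl // lead_coefXn size_polyDl // size_polyXn.
have sp : (size (g - 'X^n)%R <= n)%N.
  apply/leq_sizeP => j; rewrite leq_eqVlt coefB coefXn => /predU1P[<-|nj].
    by rewrite eqxx -[n]/(n.+1.-1) -sg -lead_coefE (monicP mg) subrr.
  by rewrite gtn_eqF // subr0 nth_default // sg.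
by exists (npolyp n (g - 'X^n)); rewrite //= npolypK // addrC subrK.
Qed.

Lemma monics_uniq n : uniq (monics n).
Proof. by rewrite map_inj_uniq ?enum_uniq // => p q /addrI/val_inj. Qed.

Definition irr n := [seq P <- monics n | irreducibleb P].

Lemma irrP n P :
  reflect [/\ P \is monic, size P = n.+1 & irreducible_poly P] (P \in irr n).
Proof.
rewrite mem_filter mem_monics.
apply: (iffP and3P) => [[/irreducibleP iP mP /eqP sP]|[mP sP iP]] //.
by rewrite mP sP eqxx; split=> //; apply/irreducibleP.
Qed.

Lemma irr_uniq n : uniq (irr n).
Proof. by rewrite filter_uniq ?monics_uniq. Qed.

Lemma monic_divp g P : g \is monic -> P \is monic -> P %| g -> g %/ P \is monic.
Proof.
by move=> mg mP Pg; rewrite -(monicMr _ mP) divpK.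
Qed.

Lemma monic_size_le1 g : g \is monic -> (size g <= 1)%N -> g = 1.
Proof.
move=> mg sg; apply/eqP; rewrite -(eqp_monic mg (monic1 _)) -size_poly_eq1.
by rewrite eqn_leq sg size_poly_gt0 monic_neq0.
Qed.

Lemma monic_irr_factor g : g \is monic -> (1 < size g)%N ->
  exists e P, P \in irr e /\ P %| g.
Proof.
move=> mg sg; pose p e := (0 < e)%N && has (fun h => h %| g) (monics e).
have ex_p : exists e, p e.
  exists (size g).-1; rewrite /p -subn1 subn_gt0 sg subn1; apply/hasP; exists g => //.
  by rewrite mem_monics mg prednK ?eqxx // ltnW.
case: (ex_minnP ex_p) => e /andP[e0 /hasP[P]].
rewrite mem_monics => /andP[mP /eqP sP] Pg min_e; exists e, P; split=> //.
apply/irrP; split=> //; split; first by rewrite sP ltnS.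
move=> q sq qP; have q0 : q != 0.
  by apply: contraTneq qP => ->; rewrite dvd0p monic_neq0.
rewrite -dvdp_size_eqp // eqn_leq dvdp_leq ?monic_neq0 //= sP.
have lq : lead_coef q != 0 by rewrite lead_coef_eq0.
have -> : size q = (size q).-1.+1 by rewrite prednK // size_poly_gt0.
rewrite ltnS; apply: min_e; apply/andP; split.
  by rewrite -subn1 subn_gt0 ltn_neqAle eq_sym sq size_poly_gt0.
apply/hasP; exists ((lead_coef q)^-1 *: q); last first.
  by rewrite dvdpZl ?invr_eq0 // (dvdp_trans qP).
rewrite mem_monics monicE lead_coefZ mulVf // eqxx size_scale ?invr_eq0 //.
by rewrite prednK ?eqxx // size_poly_gt0.
Qed.

Lemma irr_dvd_eq e1 e2 P Q : P \in irr e1 -> Q \in irr e2 -> P %| Q -> P = Q.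
Proof.
move=> /irrP[mP sP iP] /irrP[mQ sQ iQ] PQ; apply/eqP; rewrite -eqp_monic //.
by apply: iQ.2 => //; rewrite neq_ltn iP.1 orbT.
Qed.

Lemma size_irrX e P i : P \in irr e -> size (P ^+ i) = (i * e).+1.
Proof.
move=> /irrP[mP sP _].
rewrite -[LHS]prednK ?size_poly_gt0 ?monic_neq0 ?monic_exp //.
by rewrite size_exp sP mulnC.
Qed.

(** The multiplicity of [P] in [g], provided [deg g <= N]. Counting the powers of [P] that divide
    [g] lets sums over [g] and over prime powers be exchanged. *)
Definition mult N P g : nat := (\sum_(1 <= i < N.+1) (P ^+ i %| g)%R)%N.

Lemma multM N e1 e2 P Q g : P \in irr e1 -> Q \in irr e2 -> g \is monic ->
  (size (Q * g)%R <= N.+1)%N -> mult N P (Q * g) = (mult N P g + (P == Q))%N.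
Proof.
move=> iP iQ mg sN; have [mP sP ip] := irrP _ _ iP; have [mQ sQ iq] := irrP _ _ iQ.
have [PQ|PQ] := eqVneq P Q; last first.
  rewrite addn0; apply: eq_bigr => i _; rewrite Gauss_dvdpr // coprimep_expl //.
  rewrite irreducible_poly_coprime //; apply: contra PQ => h.
  by rewrite (irr_dvd_eq iP iQ h).
rewrite -PQ in sN *; rewrite size_monicM ?monic_neq0 // in sN.
have sP2 : (1 < size P)%N := ip.1.
case: N sN => [|N] sN.
  have : (0 < size g)%N by rewrite size_poly_gt0 monic_neq0.
  move: sN sP2; case: (size P) => [|[|a]] //; case: (size g) => // b.
  by rewrite addnS addSn.
rewrite /mult [in LHS]big_nat_recl // [in RHS]big_nat_recr //= expr1 dvdp_mulr //.
rewrite [X in _ = (_ + X + _)%N](_ : _ = 0%N); last first.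
  apply/eqP; rewrite eqb0; apply/negP => /dvdp_leq; rewrite monic_neq0 // => /(_ isT).
  rewrite (size_irrX _ iP); move: sN sP2; rewrite sP ltnS => sN e10.
  move=> hs; have := leq_trans (leq_add e10 hs) sN; rewrite add1n !ltnS.
  by rewrite leqNgt leq_pmulr.
rewrite addn0 addnC; congr addn; apply: eq_big_nat => i _.
by rewrite exprS dvdp_mul2l // monic_neq0.
Qed.

(** Polynomial analogue of [log n] as the sum of the von Mangoldt function over the divisors of [n].
    Removing an irreducible factor [Q] lowers the degree by [deg Q] and, among all multiplicities,
    only that of [Q], by one. *)
Lemma degree_irr N g : g \is monic -> (size g <= N.+1)%N ->
  (\sum_(1 <= e < N.+1) \sum_(P <- irr e) e * mult N P g = (size g).-1)%N.
Proof.
have [n] := ubnP (size g); elim: n g => // n IHn g; rewrite ltnS => gn mg gN.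
have [sg|sg] := leqP (size g) 1.
  rewrite (monic_size_le1 mg sg) size_poly1 /=; apply: big1_seq => e _; apply: big1_seq => P /andP[_ iP].
  rewrite /mult big_nat big1 ?muln0 // => i /andP[i0 _].
  apply/eqP; rewrite eqb0 dvdp1 (size_irrX _ iP) eqSS -lt0n muln_gt0 i0.
  by have [_ sP [sP1 _]] := irrP _ _ iP; rewrite sP in sP1.
have [e0 [Q [iQ Qg]]] := monic_irr_factor mg sg.
have [mQ sQ [sQ1 _]] := irrP _ _ iQ.
have mh := monic_divp mg mQ Qg; set h := g %/ Q in mh.
have gE : g = Q * h by rewrite mulrC divpK.
have e00 : (0 < e0)%N by rewrite -ltnS -sQ.
have h0 : (0 < size h)%N by rewrite size_poly_gt0 monic_neq0.
have sgE : size g = (e0 + size h)%N by rewrite gE size_monicM ?monic_neq0 // sQ.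
rewrite (eq_bigr (fun e => \sum_(P <- irr e) e * mult N P h +
    \sum_(P <- irr e) e * (P == Q)))%N; last first.
  move=> e _; rewrite -big_split /= big_seq [RHS]big_seq; apply: eq_bigr => P iP.
  by rewrite gE (multM iP iQ mh) ?mulnDr // -gE.
rewrite big_split /= IHn //; first last.
- by apply: leq_trans gN; rewrite sgE leq_addl.
- by rewrite (leq_trans _ gn) // sgE -[X in (X < _)%N]add0n ltn_add2r.
rewrite (bigD1_seq e0) ?iota_uniq //=; last first.
  by rewrite mem_index_iota e00 (leq_trans _ gN) // sgE -addn1 leq_add2l.
rewrite (bigD1_seq Q) ?irr_uniq //= eqxx muln1.
rewrite [X in (e0 + X + _)%N]big1 => [|P /negPf ->]; last by rewrite muln0.
rewrite big1_seq => [|e /andP[ee _]].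
  by rewrite sgE !addn0 addnC -{2}(prednK h0) addnS.
apply: big1_seq => P /andP[_ iP]; case: eqP => [PQ|]; last by rewrite muln0.
by have [_ sP _] := irrP _ _ iP; move: ee; rewrite -eqSS -sP -sQ PQ eqxx.
Qed.

End Monics.

(** * The Euler product and its logarithmic derivative *)

Section Recurrence.
Variables (K : finFieldType) (C : fieldType) (Psi : {poly K} -> C).
Hypothesis Psi1 : Psi 1 = 1.
Hypothesis PsiM : forall g h, Psi (g * h) = Psi g * Psi h.

Definition lcoef n : C := \sum_(g <- monics K n) Psi g.
(** The coefficient of [T^n] in [T L' / L] for the Euler product [L]: the value of [Psi] at each
    prime power [P ^+ i] of degree [n], weighted by [deg P]. *)
Definition lpow n : C :=
  \sum_(1 <= e < n.+1 | (e %| n)%N) \sum_(P <- irr K e) e%:R * Psi P ^+ (n %/ e).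

Lemma PsiX g i : Psi (g ^+ i) = Psi g ^+ i.
Proof. by elim: i => [|i IHi]; rewrite ?expr0 // !exprS PsiM IHi. Qed.

Lemma sum_monics_dvd n e i P : P \in irr K e ->
  \sum_(g <- monics K n | P ^+ i %| g) Psi g =
  if (i * e <= n)%N then Psi P ^+ i * lcoef (n - i * e) else 0.
Proof.
move=> iP; have sPi := size_irrX i iP; have [mP _ _] := irrP _ _ iP.
have mPi : P ^+ i \is monic by rewrite monic_exp.
case: leqP => hn; last first.
  rewrite big_seq_cond big1 // => g /andP[]; rewrite mem_monics => /andP[mg /eqP sg].
  by move/dvdp_leq; rewrite monic_neq0 // => /(_ isT); rewrite sg sPi ltnS leqNgt hn.
rewrite -big_filter /lcoef mulr_sumr; under [RHS]eq_bigr do rewrite -PsiX -PsiM.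
rewrite -(big_map (fun h => P ^+ i * h) predT Psi); apply: perm_big.
have P0 : P ^+ i != 0 by rewrite monic_neq0.
apply: uniq_perm; first by rewrite filter_uniq // monics_uniq.
  by rewrite map_inj_uniq ?monics_uniq //; apply: mulfI.
move=> g; rewrite mem_filter mem_monics; apply/andP/mapP.
  move=> [Pg /andP[mg /eqP sg]]; have mh := monic_divp mg mPi Pg.
  exists (g %/ P ^+ i); last by rewrite mulrC divpK.
  have sgE : size g = (i * e + size (g %/ P ^+ i)%R)%N.
    by rewrite -{1}(divpK Pg) mulrC size_monicM ?monic_neq0 // sPi.
  rewrite mem_monics mh; apply/eqP/(@addnI (i * e)).
  by rewrite -sgE addnS subnKC.
case=> h; rewrite mem_monics => /andP[mh /eqP sh] ->; rewrite dvdp_mulr //.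
split=> //; rewrite monicMl // mh size_monicM ?monic_neq0 // sPi sh addSn /= addnS.
by rewrite subnKC.
Qed.

(** On the left each monic [g] counts [n = deg g] times; [degree_irr] spreads this weight over the
    prime powers [P ^+ i] dividing [g]. Exchanging the sums and writing [g = P ^+ i * h] leaves
    [lcoef] at the remaining degree. *)
Lemma lcoef_recurrence n :
  n%:R * lcoef n = \sum_(j < n) lcoef (n - j.+1) * lpow j.+1.
Proof.
transitivity (\sum_(1 <= e < n.+1) \sum_(P <- irr K e) \sum_(1 <= i < n.+1)
    (if (i * e <= n)%N then e%:R * Psi P ^+ i * lcoef (n - i * e) else 0)).
  transitivity (\sum_(g <- monics K n) \sum_(1 <= e < n.+1) \sum_(P <- irr K e)
      \sum_(1 <= i < n.+1) (if P ^+ i %| g then e%:R * Psi g else 0)).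
    rewrite /lcoef mulr_sumr !big_seq; apply: eq_bigr => g.
    rewrite mem_monics => /andP[mg /eqP sg].
    have nE : n = (\sum_(1 <= e < n.+1) \sum_(P <- irr K e) e * mult n P g)%N.
      by rewrite degree_irr ?sg.
    rewrite {1}nE natr_sum mulr_suml; apply: eq_bigr => e _.
    rewrite natr_sum mulr_suml; apply: eq_bigr => P _.
    rewrite /mult natrM natr_sum mulrAC mulr_sumr; apply: eq_bigr => i _.
    by case: ifP => _; rewrite ?mulr1 ?mulr0.
  rewrite exchange_big; apply: eq_bigr => e _.
  rewrite exchange_big big_seq [RHS]big_seq; apply: eq_bigr => P iP.
  rewrite exchange_big; apply: eq_bigr => i _.
  rewrite -big_mkcond -mulr_sumr (sum_monics_dvd n i iP).
  by case: ifP => _; rewrite ?mulr0 // mulrA.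
rewrite -(big_mkord predT (fun j => lcoef (n - j.+1) * lpow j.+1)).
rewrite -(big_add1 _ _ 0 n.+1 predT (fun j => lcoef (n - j) * lpow j)).
transitivity (\sum_(1 <= j < n.+1) \sum_(1 <= e < n.+1 | (e %| j)%N)
    \sum_(P <- irr K e) lcoef (n - j) * (e%:R * Psi P ^+ (j %/ e))); last first.
  apply: eq_big_nat => j /andP[j0 jn]; rewrite /lpow mulr_sumr.
  rewrite [RHS](@big_nat_widen _ _ _ _ _ n.+1) //.
  rewrite [RHS]big_mkcondr [LHS]big_mkcond [RHS]big_mkcond.
  apply: eq_bigr => e _; case: ifP => // ej; rewrite ltnS (dvdn_leq j0 ej).
  by rewrite mulr_sumr.
rewrite (exchange_big_dep predT) //=; apply: eq_big_nat => e /andP[e0 _].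
rewrite [RHS]exchange_big; apply: eq_bigr => P _ /=.
pose F i j := lcoef (n - j) * (e%:R * Psi P ^+ i).
transitivity (\sum_(1 <= i < n.+1) \sum_(1 <= j < n.+1 | j == (i * e)%N) F i j).
  apply: eq_big_nat => i /andP[i0 _]; case: leqP => ie; last first.
    rewrite big_nat_cond big1 // => j /andP[/andP[_ jn] /eqP jE].
    by move: jn; rewrite jE ltnS leqNgt ie.
  rewrite -big_filter (_ : [seq _ <- _ | _] = [:: (i * e)%N]) ?big_seq1.
    by rewrite mulrC.
  rewrite filter_pred1_uniq ?iota_uniq //.
  by rewrite mem_index_iota muln_gt0 i0 e0.
rewrite (exchange_big_dep predT) //= [RHS]big_mkcond; apply: eq_big_nat => j /andP[j0 jn].
case: ifP => ej; last first.
  rewrite big_pred0 // => i; apply/negP => /eqP jE.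
  by rewrite jE dvdn_mull in ej.
rewrite -big_filter (_ : [seq _ <- _ | _] = [:: (j %/ e)%N]) ?big_seq1 //.
rewrite -(filter_pred1_uniq (s := index_iota 1 n.+1)) ?iota_uniq //.
  by apply: eq_filter => i /=; rewrite -{1}(divnK ej) eqn_pmul2r // eq_sym.
rewrite mem_index_iota divn_gt0 // (dvdn_leq j0 ej) ltnS.
by rewrite -ltnS; apply: leq_ltn_trans (leq_div _ _) jn.
Qed.
End Recurrence.

(** * Points over an extension field *)

Lemma card_pchar_nat (K : finFieldType) (E : nzRingType) (f : {rmorphism K -> E}) :
  [pchar E].-nat #|K|.
Proof.
have [p pr_p pK] := finPcharP K.
rewrite (eq_pnat _ (pcharf_eq (rmorph_pchar f pK))).
by rewrite -[#|K|]/#|pPrimeCharType pK| card_pprimeChar pnatX pnat_id.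
Qed.

Section Points.
Variables (K E : finFieldType) (f : {rmorphism K -> E}) (n : nat).
Let q := #|K|.
Hypotheses (n_gt0 : (0 < n)%N) (cE : #|E| = (q ^ n)%N).
Local Notation "g ^f" := (map_poly f g).

Lemma frob_horner (g : {poly K}) (x : E) l : g^f.[x] ^+ (q ^ l) = g^f.[x ^+ (q ^ l)].
Proof.
have hq : [pchar E].-nat (q ^ l)%N by rewrite pnatX card_pchar_nat.
rewrite !horner_coef expr_sum_pchar //; apply: eq_bigr => i _.
rewrite exprMn exprAC coef_map -rmorphXn /=; congr (f _ * _).
by elim: l {hq} => [|l IHl]; rewrite ?expr1 // expnSr exprM IHl expf_card.
Qed.

Lemma frob_inj l : injective (fun x : E => x ^+ (q ^ l)).
Proof.
move=> x y /eqP; rewrite -subr_eq0 -exprBn_pchar; last by rewrite pnatX card_pchar_nat.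
by rewrite expf_eq0 subr_eq0 => /andP[_ /eqP].
Qed.

Lemma frob_n (x : E) : x ^+ (q ^ n) = x.
Proof. by rewrite -cE expf_card. Qed.

Lemma frob_mul (x : E) l m : x ^+ (q ^ l) = x -> x ^+ (q ^ (l * m)) = x.
Proof.
move=> xl; elim: m => [|m IHm]; first by rewrite muln0.
by rewrite mulnS expnD exprM xl.
Qed.

Lemma qn_gt1 l : (0 < l)%N -> (1 < q ^ l)%N.
Proof. by move=> l0; rewrite -(exp1n l) ltn_exp2r // finNzRing_gt1. Qed.

(** Let [e'] be the least period of [x] under the [q]-Frobenius. The orbit consists of [e'] distinct
    roots of [P], so [e' <= e]; evaluation at [x] embeds the polynomials of degree less than [e]
    into the roots of ['X^(q ^ e') - 'X], so [e <= e']. *)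
Lemma irr_root_prod e P x : P \in irr K e -> root P^f x ->
  [/\ P^f = \prod_(0 <= l < e) ('X - (x ^+ (q ^ l))%:P), (e %| n)%N &
      x ^+ (q ^ e) = x].
Proof.
move=> iP rx; have [mP sP [sP1 _]] := irrP _ _ iP.
pose p l := (0 < l)%N && (x ^+ (q ^ l) == x).
have ex_p : exists l, p l by exists n; rewrite /p n_gt0 frob_n eqxx.
case: (ex_minnP ex_p) => e' /andP[e'0 /eqP xe'] min_e'.
have e'n : (e' %| n)%N.
  rewrite /dvdn -leqn0 leqNgt; apply/negP => r0.
  have := min_e' (n %% e')%N; rewrite /p r0 leqNgt ltn_pmod //=.
  move=> /implyP; rewrite implybF.
  case/negP; apply/eqP; rewrite -[RHS]frob_n {2}(divn_eq n e') expnD exprM mulnC.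
  by rewrite frob_mul.
pose s := [seq x ^+ (q ^ l) | l <- index_iota 0 e'].
have us : uniq s.
  rewrite map_inj_in_uniq ?iota_uniq // => i j.
  rewrite !mem_index_iota /=; wlog ij : i j / (i <= j)%N.
    by move=> H hi hj h; case/orP: (leq_total i j) => ?; [|symmetry]; apply: H.
  move=> _ je h; apply/eqP; rewrite eqn_leq ij leqNgt; apply/negP => lij.
  have := min_e' (j - i)%N; rewrite /p subn_gt0 lij leqNgt (leq_ltn_trans (leq_subr _ _) je).
  move/implyP; rewrite implybF => /negP; apply; apply/eqP/(@frob_inj i).
  by rewrite /= -exprM -expnD subnK.
have rs : all (root P^f) s.
  apply/allP => _ /mapP[l _ ->]; rewrite rootE -frob_horner.
  move: rx; rewrite rootE => /eqP ->.
  by rewrite expr0n expn_eq0 (gtn_eqF (ltnW (finNzRing_gt1 K))).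
have sPf : size P^f = e.+1 by rewrite size_map_poly.
have ss : size s = e' by rewrite size_map size_iota subn0.
have ee' : (e <= e')%N.
  rewrite -(leq_exp2l _ _ (finNzRing_gt1 K)) -card_npoly.
  pose ev (g : {poly_e K}) : E := (val g)^f.[x].
  have ev_inj : injective ev.
    move=> g h /eqP; rewrite -subr_eq0 /ev -hornerN -hornerD -rmorphN -rmorphD /= => gh.
    apply/val_inj/eqP; rewrite -subr_eq0; apply: contraTT gh => gh0.
    have : coprimep P (val g - val h).
      rewrite irreducible_poly_coprime; last by case/irrP: iP.
      apply/negP => /dvdp_leq; rewrite gh0 => /(_ isT); rewrite sP leqNgt ltnS.
      by rewrite (leq_trans (size_polyD _ _)) // size_polyN geq_max !size_npoly.
    by rewrite -(coprimep_map f) => /coprimep_root; apply.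
  rewrite -(card_codom ev_inj) cardE.
  have : (size (enum (codom ev)) < size ('X^(q ^ e') - 'X : {poly E})%R)%N.
    apply: max_poly_roots; last exact: enum_uniq.
      rewrite -size_poly_eq0 size_polyDl ?size_polyXn // size_polyN size_polyX ltnS.
      exact: qn_gt1.
    apply/allP => y; rewrite mem_enum => /codomP[g ->].
    by rewrite rootE !hornerE /ev frob_horner xe' subrr.
  by rewrite size_polyDl size_polyXn ?size_polyN ?size_polyX ?ltnS ?qn_gt1 // -cardE.
have e'e : (e' <= e)%N.
  rewrite -ltnS -sPf -ss; apply: max_poly_roots => //.
  by rewrite -size_poly_eq0 sPf.
have eE : e = e' by apply/eqP; rewrite eqn_leq ee' e'e.
split; try by rewrite eE.
have := all_roots_prod_XsubC _ rs; rewrite uniq_rootsE => /(_ _ us) ->; last first.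
  by rewrite sPf ss eE.
by rewrite lead_coef_map (monicP mP) rmorph1 scale1r big_map eE.
Qed.

(** The quotient of [K[X]] by [P] is a field with [q ^ e] elements and [e %| n], so [P] divides
    ['X^(q ^ n) - 'X], a product of distinct linear factors over [E]. *)
Lemma irr_card_roots e P : P \in irr K e -> (e %| n)%N ->
  #|[set x : E | root P^f x]| = e.
Proof.
move=> iP en; have [mP sP irP] := irrP _ _ iP.
have PX : P %| 'X^(q ^ n) - 'X.
  have hI : monic_irreducible_poly P by split.
  pose F : finFieldType := {poly %/ P with hI}.
  have cF : #|F| = (q ^ e)%N by rewrite card_qfpoly sP.
  have XF : (in_qpoly P 'X : F) ^+ (q ^ n) = in_qpoly P 'X.
    rewrite -(divnK en) mulnC; elim: (n %/ e)%N => [|m IHm]; first by rewrite muln0.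
    by rewrite mulnS expnD exprM -cF expf_card.
  have : in_qpoly P ('X^(q ^ n) - 'X) = 0.
    rewrite rmorphB rmorphXn /=; apply/eqP; rewrite subr_eq0; apply/eqP; exact: XF.
  move/(congr1 (fun p => polyn p)) => /= h0.
  by rewrite dvdpE; apply/eqP; rewrite -[RHS]h0 (mk_monicE hI).
have : P^f %| \prod_(x <- enum E) ('X - x%:P).
  have : P^f %| ('X^(q ^ n) - 'X)^f by rewrite dvdp_map.
  by rewrite rmorphB /= map_polyXn map_polyX -cE finField_genPoly -big_enum.
case/dvdp_prod_XsubC => m hm.
have um : uniq (mask m (enum E)) by rewrite mask_uniq ?enum_uniq.
rewrite -[RHS]/(e.+1.-1) -sP -(size_map_poly f) (eqp_size hm) size_prod_XsubC /=.
rewrite -(card_uniqP um); apply: eq_card => x.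
by rewrite inE (eqp_root hm) root_prod_XsubC.
Qed.

Lemma exists_irr_root (x : E) : exists e P,
  [/\ P \in irr K e, root P^f x, (0 < e)%N & (e %| n)%N].
Proof.
suff [e [P [iP rP]]] : exists e P, P \in irr K e /\ root P^f x.
  exists e, P; split=> //; last by case: (irr_root_prod iP rP).
  by have [_ sP [sP1 _]] := irrP _ _ iP; rewrite sP in sP1.
have : exists g : {poly K}, g \is monic /\ root g^f x.
  exists ('X^(q ^ n) - 'X); split; last first.
    by rewrite rmorphB /= map_polyXn map_polyX rootE !hornerE frob_n subrr.
  by rewrite monicE lead_coefDl ?lead_coefXn // size_polyN size_polyX size_polyXn ltnS qn_gt1.
case=> g; have [N] := ubnP (size g); elim: N g => // N IHN g gN [mg rg].
have sg : (1 < size g)%N.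
  rewrite ltnNge; apply/negP => sg; move: rg.
  by rewrite (monic_size_le1 mg sg) rmorph1 (negPf (root1 _)).
have [e [P [iP Pg]]] := monic_irr_factor mg sg.
have [mP sP [sP1 _]] := irrP _ _ iP.
have mh := monic_divp mg mP Pg.
have gE : g = (g %/ P) * P by rewrite divpK.
move: rg; rewrite {1}gE rmorphM rootM => /orP[rh|]; last by exists e, P.
apply: (IHN (g %/ P)) => //; rewrite -ltnS; apply: leq_ltn_trans gN.
have -> : size g = (size (g %/ P)%R + e)%N.
  by rewrite {1}gE size_monicM ?monic_neq0 // sP addnS.
by rewrite -addn1 leq_add2l; rewrite sP in sP1.
Qed.

(** Every [x] in [E] is a root of exactly one irreducible [P], of some degree [e %| n], which has
    [e] roots in [E]; the characteristic polynomial of [x] over [K] is [P ^+ (n %/ e)]. *)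
Lemma sum_irr_points (C : fieldType) (G : {poly K} -> C) (G' : E -> C) :
  (forall g x, g^f = \prod_(0 <= l < n) ('X - (x ^+ (q ^ l))%:P) -> G g = G' x) ->
  \sum_(1 <= e < n.+1 | (e %| n)%N) \sum_(P <- irr K e) e%:R * G (P ^+ (n %/ e))
  = \sum_x G' x.
Proof.
move=> GG'.
transitivity (\sum_(1 <= e < n.+1 | (e %| n)%N) \sum_(P <- irr K e)
    \sum_(x : E) (if root P^f x then G' x else 0)).
  apply: eq_bigr => e en; rewrite big_seq [RHS]big_seq; apply: eq_bigr => P iP.
  rewrite -big_mkcond /= (eq_bigr (fun=> G (P ^+ (n %/ e)))) => [|x rx].
    rewrite big_const iter_addr_0 mulr_natl; congr (_ *+ _).
    by rewrite -[LHS](irr_card_roots iP en); apply: eq_card => x; rewrite inE.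
  apply/esym/GG'; rewrite rmorphXn /=; have [-> _ xe] := irr_root_prod iP rx.
  rewrite -{2}(divnK en); elim: (n %/ e)%N => [|m IHm]; first by rewrite expr0 big_geq.
  rewrite exprS mulSn [RHS](@big_cat_nat _ _ _ e) ?leq_addr //= IHm; congr (_ * _).
  rewrite -[X in _ = \prod_(X <= _ < _) _]add0n big_addn addKn.
  by apply: eq_bigr => l _; rewrite expnD mulnC exprM xe.
under eq_bigr => e _ do rewrite exchange_big.
rewrite exchange_big; apply: eq_bigr => x _ /=.
have [e0 [P0 [iP0 rP0 e00 e0n]]] := exists_irr_root x.
have rE e P : P \in irr K e -> root P^f x = (P == P0).
  move=> iP; apply/idP/eqP => [rP|->//]; apply: (irr_dvd_eq iP iP0).
  apply: contraTT rP; rewrite -irreducible_poly_coprime; last by case/irrP: iP.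
  by rewrite -(coprimep_map f) coprimep_sym => /coprimep_root; apply.
rewrite big_mkcond (bigD1_seq e0) ?e0n //=; first last.
- exact: iota_uniq.
- by rewrite mem_index_iota e00 ltnS dvdn_leq.
rewrite (bigD1_seq P0) ?irr_uniq //= rP0.
rewrite [X in _ + X + _]big1_seq => [|P /andP[PP iP]]; last first.
  by rewrite (rE _ _ iP) (negPf PP).
rewrite big1 ?addr0 // => e ee; case: ifP => // _; apply: big1_seq => P /andP[_ iP].
rewrite (rE _ _ iP); case: eqP => // PP.
have [_ sP _] := irrP _ _ iP; have [_ sP0 _] := irrP _ _ iP0.
by move: ee; rewrite -eqSS -sP -sP0 PP eqxx.
Qed.
End Points.

(** [E] is the splitting field of ['X^m - 'X]. The roots are the fixed points of [a ^+ n], with [a]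
    the Frobenius, hence a subfield, hence everything; they number [m] because the derivative of
    ['X^m - 'X] is [-1]. *)
Lemma finField_ext (F : finFieldType) (n : nat) : (0 < n)%N ->
  {E : finFieldType & {f : {rmorphism F -> E} | #|E| = (#|F| ^ n)%N}}.
Proof.
move=> n_gt0; pose m := (#|F| ^ n)%N.
have m_gt1 : (1 < m)%N by rewrite /m -(exp1n n) ltn_exp2r // finNzRing_gt1.
have mon (R : nzRingType) : ('X^m - 'X : {poly R}) \is monic.
  by rewrite monicE lead_coefDl ?lead_coefXn // size_polyN size_polyX size_polyXn ltnS.
have /FinSplittingFieldFor[/= L splitLq] : ('X^m - 'X : {poly F}) != 0 by exact/monic_neq0/mon.
rewrite rmorphB rmorphXn /= map_polyX in splitLq.
pose E := FinFieldExtType L; exists E.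
exists (in_alg L : {rmorphism F -> L}).
have [/= a _ Da] := finField_galois_generator (subvf (1%AS : {subfield L})).
pose Em := fixedSpace (a ^+ n)%g; rewrite dimv1 expn1 in Da.
have [zs DqL defL] := splitLq.
have Frob (z : L) : (a ^+ n)%g z = z ^+ m.
  rewrite /m; elim: (n) => [|i IHi]; first by rewrite gal_id.
  by rewrite expgSr expnSr exprM -IHi galM ?memvf // Da ?memvf.
have in_zs : zs =i Em.
  move=> z; rewrite -root_prod_XsubC -(eqp_root DqL) (sameP fixedSpaceP eqP).
  by rewrite /root !hornerE subr_eq0 Frob.
have defEm : Em = {:L}%VS.
  apply/eqP; rewrite eqEsubv subvf -defL -[Em]subfield_closed agenvS //.
  by rewrite subv_add sub1v; apply/span_subvP=> z; rewrite in_zs.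
have Uzs : uniq zs.
  rewrite -separable_prod_XsubC -(eqp_separable DqL) unlock derivB derivXn derivX.
  have -> : 'X^(m.-1) *+ m = 0 :> {poly L}.
    have pm : [pchar L].-nat m by rewrite pnatX (card_pchar_nat (in_alg L)).
    have pL : pdiv m \in [pchar L] by rewrite (pnatPpi pm) ?pi_pdiv.
    have /eqP m0 : m%:R == 0 :> L by rewrite -(dvdn_pcharf pL) pdiv_dvd.
    by rewrite -scaler_nat m0 scale0r.
  by rewrite sub0r -polyCN -[_%:P]alg_polyC coprimepZr ?oppr_eq0 ?oner_eq0 // coprimep1.
rewrite -/m -(@eq_card E (mem zs)); last first.
  by move=> z; rewrite in_zs defEm memvf.
apply: succn_inj; rewrite (card_uniqP _) //= -(size_prod_XsubC _ id).
by rewrite -(eqp_size DqL) size_polyDl size_polyXn // size_polyN size_polyX.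
Qed.

(** * Multiplicative characters *)

(** Every nonzero element is a power of [w], so [chi] is the character of order [d] sending [w] to
    [z], extended by [chi 0 = 0]. Since [0 ^+ 0 = 1], the exponent [0] gives the constant [1], also
    at [0]. *)
Definition is_char (L : finFieldType) (d : nat) (w : L) (z : algC) (chi : L -> algC) :=
  [/\ #|L|.-1.-primitive_root w, d.-primitive_root z, chi 0 = 0 &
      forall i, chi (w ^+ i) = z ^+ i].

Lemma expf_card_pred (L : finFieldType) (y : L) : y != 0 -> y ^+ #|L|.-1 = 1.
Proof.
move=> y0; apply: (mulfI y0).
by rewrite -exprS prednK ?expf_card ?mulr1 // (ltn_trans _ (finNzRing_gt1 L)).
Qed.

Lemma card_pred_gt0 (L : finFieldType) : (0 < #|L|.-1)%N.
Proof. by rewrite -ltnS prednK ?finNzRing_gt1 // ltnW // finNzRing_gt1. Qed.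

Lemma prim_root_log (L : finFieldType) (w y : L) :
  #|L|.-1.-primitive_root w -> y != 0 -> exists i, y = w ^+ i.
Proof.
move=> pw y0; have [i ->] := prim_rootP pw (expf_card_pred y0).
by exists i.
Qed.

Lemma exists_char (L : finFieldType) (d : nat) : (d %| #|L|.-1)%N ->
  exists w z chi, @is_char L d w z chi.
Proof.
move=> dL; have N0 := card_pred_gt0 L; have d0 := dvdn_gt0 N0 dL.
pose rs := [seq y <- enum L | y != 0].
have : has #|L|.-1.-primitive_root rs.
  apply: cyclic.has_prim_root => //.
  - by apply/allP => y; rewrite mem_filter => /andP[y0 _]; apply/unity_rootP/expf_card_pred.
  - by rewrite filter_uniq ?enum_uniq.
  - rewrite /rs size_filter -(cardC1 (0 : L)) cardE -size_filter.
    rewrite /enum_mem -filter_predI; apply/eq_leq/congr1/eq_filter => y.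
    by rewrite !inE andbT.
case/hasP => w _ pw; have [z pz] := C_prim_root_exists d0.
pose chi y := if [pick i : 'I_#|L|.-1 | w ^+ i == y] is Some i then z ^+ i else 0.
exists w, z, chi; split=> //.
  rewrite /chi; case: pickP => // i.
  by rewrite expf_eq0 (prim_root_eq0 pw) (gtn_eqF N0) andbF.
move=> i; rewrite /chi; case: pickP => [j /eqP|/(_ (Ordinal (ltn_pmod i N0)))] /=; last first.
  by rewrite prim_expr_mod // eqxx.
move/eqP; rewrite (eq_prim_root_expr pw) => /eqP ij; apply/eqP.
by rewrite (eq_prim_root_expr pz) -(modn_dvdm j dL) ij modn_dvdm.
Qed.

Section CharTheory.
Variables (L : finFieldType) (d : nat) (w : L) (z : algC) (chi : L -> algC).
Hypothesis chiP : is_char d w z chi.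

Lemma char1 : chi 1 = 1.
Proof. by case: chiP => _ _ _ h; rewrite -(expr0 w) h expr0. Qed.

Lemma charM : {morph chi : x y / x * y}.
Proof.
case: chiP => pw pz h0 h x y.
have [->|x0] := eqVneq x 0; first by rewrite mul0r h0 mul0r.
have [->|y0] := eqVneq y 0; first by rewrite mulr0 h0 mulr0.
have [i ->] := prim_root_log pw x0; have [j ->] := prim_root_log pw y0.
by rewrite -exprD !h exprD.
Qed.

Lemma charX x n : chi (x ^+ n) = chi x ^+ n.
Proof. by elim: n => [|n IHn]; rewrite ?char1 // !exprS charM IHn. Qed.

Lemma char_prod (I : finType) (F : I -> L) : chi (\prod_i F i) = \prod_i chi (F i).
Proof. exact: (big_morph chi charM char1). Qed.

Lemma dvdn_char : (d %| #|L|.-1)%N.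
Proof.
case: chiP => pw pz h0 h; rewrite (prim_order_dvd pz) -h (prim_expr_order pw).
by rewrite char1.
Qed.

Lemma char_eq1 x : x != 0 -> (chi x == 1) = (x ^+ (#|L|.-1 %/ d) == 1).
Proof.
case: chiP => pw pz h0 h x0; have [i ->] := prim_root_log pw x0.
rewrite h -exprM -(prim_order_dvd pz) -(prim_order_dvd pw).
have := divnK dvdn_char; set c := (_ %/ d)%N => NE.
rewrite -[X in _ = (X %| _)%N]NE mulnC dvdn_pmul2r //.
by rewrite divn_gt0 ?(prim_order_gt0 pz) // dvdn_leq ?dvdn_char // card_pred_gt0.
Qed.

Lemma char_unity x : x != 0 -> chi x ^+ d = 1.
Proof.
case: chiP => pw pz h0 h x0; have [i ->] := prim_root_log pw x0.
by rewrite h exprAC (prim_expr_order pz) expr1n.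
Qed.

Lemma char_norm x : `|chi x| <= 1.
Proof.
have [->|x0] := eqVneq x 0; first by case: chiP => _ _ -> _; rewrite normr0 ler01.
have d0 : (0 < d)%N by case: chiP => _ pz _ _; apply: prim_order_gt0 pz.
have : `|chi x| ^+ d = 1 by rewrite -normrX char_unity // normr1.
by move/eqP; rewrite pexpr_eq1 // => /eqP ->.
Qed.

(** The substitution [y := w * y] multiplies the unshifted sum by [z ^+ a], which is not [1]. *)
Lemma sum_char_shift a c : ~~ (d %| a)%N -> \sum_y chi (c + y) ^+ a = 0.
Proof.
move=> da; rewrite -[RHS]addr0.
have -> : \sum_y chi (c + y) ^+ a = \sum_y chi y ^+ a.
  by rewrite [RHS](reindex_inj (addrI c)).
case: chiP => pw pz h0 h.
have w0 : w != 0 by rewrite (prim_root_eq0 pw) gtn_eqF // card_pred_gt0.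
set S := \sum_y _; have : z ^+ a * S = S.
  rewrite /S mulr_sumr [RHS](reindex_inj (mulfI w0)); apply: eq_bigr => y _.
  by rewrite charM exprMn -{1}[z]expr1 -h expr1.
move/eqP; rewrite -subr_eq0 -[X in _ - X]mul1r -mulrBl mulf_eq0 subr_eq0.
by rewrite -(prim_order_dvd pz) (negPf da) addr0 => /eqP.
Qed.

Lemma sum_char_pow x : x != 0 ->
  \sum_(a < d) chi x ^+ a = if x ^+ (#|L|.-1 %/ d) == 1 then d%:R else 0.
Proof.
move=> x0; rewrite -char_eq1 //; case: eqP => [->|/eqP x1].
  under eq_bigr do rewrite expr1n.
  by rewrite sumr_const card_ord.
have := subrX1 (chi x) d; rewrite char_unity // subrr => /esym/eqP.
by rewrite mulf_eq0 subr_eq0 (negPf x1) => /eqP.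
Qed.

End CharTheory.

(** * The L-function *)

(** ['X^#|F| - 'X] splits into linear factors over [F], so it has no roots in [E] beyond the image
    of [f]. *)
Lemma expf_card_image (F E : finFieldType) (f : {rmorphism F -> E}) (y : E) :
  y ^+ #|F| = y -> exists x, y = f x.
Proof.
move=> yF; have := congr1 (fun p => (map_poly f p).[y]) (finField_genPoly F).
rewrite rmorphB /= map_polyXn map_polyX !hornerE yF subrr rmorph_prod horner_prod.
move/esym/eqP/prodf_eq0 => [x _ /eqP h]; exists x; apply/eqP; rewrite -subr_eq0.
by move: h; rewrite rmorphB /= map_polyX map_polyC hornerXsubC => ->.
Qed.

Section LFunction.
Variables (K L : finFieldType) (iota : {rmorphism K -> L}) (k : nat).
Variables (u : 'I_k -> L) (a : 'I_k -> nat).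
Variables (d : nat) (w : L) (z : algC) (chi : L -> algC).
Let q := #|K|.
Hypothesis cL : #|L| = (q ^ 2)%N.
Hypothesis chiP : is_char d w z chi.
Hypothesis uK : forall i x, u i != iota x.
Hypothesis u_conj : forall i j, i != j -> u i != u j /\ u i != u j ^+ q.

Definition Psi (g : {poly K}) : algC := \prod_i chi (map_poly iota g).[u i] ^+ a i.

Lemma Psi1 : Psi 1 = 1.
Proof. by apply: big1 => i _; rewrite rmorph1 hornerC (char1 chiP) expr1n. Qed.

Lemma PsiM g h : Psi (g * h) = Psi g * Psi h.
Proof.
rewrite -big_split; apply: eq_bigr => i _ /=.
by rewrite rmorphM hornerM (charM chiP) exprMn.
Qed.

Lemma lcoef0 : lcoef Psi 0 = 1.
Proof.
rewrite /lcoef (perm_big [:: 1]) /= ?big_seq1 ?Psi1 //.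
apply: uniq_perm; rewrite ?monics_uniq // => g; rewrite mem_monics inE.
apply/andP/eqP => [[mg /eqP sg]|->]; last by rewrite monic1 size_poly1.
by apply/eqP; rewrite -(eqp_monic mg (monic1 _)) -size_poly_eq1 sg.
Qed.

Lemma lcoef1 : lcoef Psi 1 = \sum_x \prod_i chi (iota x + u i) ^+ a i.
Proof.
rewrite /lcoef (perm_big [seq 'X + x%:P | x <- enum K]) /=.
  rewrite big_map big_enum; apply: eq_bigr => x _; apply: eq_bigr => i _.
  by rewrite rmorphD /= map_polyX map_polyC hornerD hornerX hornerC addrC.
apply: uniq_perm; first exact: monics_uniq.
  by rewrite map_inj_uniq ?enum_uniq // => x y /addrI/polyC_inj.
move=> g; rewrite mem_monics; apply/andP/mapP => [[mg /eqP sg]|[x _ ->]].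
  exists g`_0; first by rewrite mem_enum.
  apply/polyP => -[|[|j]]; rewrite coefD coefX coefC /= ?add0r ?addr0 //.
    by have := monicP mg; rewrite lead_coefE sg.
  by rewrite nth_default // sg.
have s1 : (size x%:P < size ('X : {poly K}))%N.
  by rewrite size_polyX (leq_ltn_trans (size_polyC_leq1 _)).
by rewrite monicE lead_coefDl // lead_coefX size_polyDl // size_polyX.
Qed.

(* A polynomial over [K] vanishing at the [u i] also vanishes at their
   conjugates, hence at [2k] distinct points. *)
Lemma eval_bij :
  bijective (fun s : {poly_(2 * k) K} => [ffun i => (map_poly iota (val s)).[u i]]).
Proof.
apply: inj_card_bij; last first.
  by rewrite card_ffun card_npoly card_ord cL expnM.
move=> s t /ffunP st; apply/val_inj/eqP; rewrite -subr_eq0.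
set g := val s - val t; apply/negPn/negP => g0.
have rg i : root (map_poly iota g) (u i).
  by rewrite rootE rmorphB hornerD hornerN subr_eq0; have := st i; rewrite !ffunE => ->.
have rgq i : root (map_poly iota g) (u i ^+ q).
  have := @frob_horner K L iota g (u i) 1; rewrite expn1 rootE => <-.
  move: (rg i); rewrite rootE => /eqP ->.
  by rewrite expr0n -(prednK (ltnW (finNzRing_gt1 K))).
pose rs := [seq u i | i <- enum 'I_k] ++ [seq u i ^+ q | i <- enum 'I_k].
have u_inj : injective u.
  by move=> i j /eqP; case: (eqVneq i j) => // /u_conj[/negPf ->].
have : (size rs < size (map_poly iota g))%N.
  apply: max_poly_roots; first by rewrite map_poly_eq0.
    by rewrite all_cat; apply/andP; split; apply/allP => _ /mapP[i _ ->].
  rewrite cat_uniq; apply/and3P; split.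
  - by rewrite map_inj_uniq // enum_uniq.
  - apply/hasPn => _ /mapP[i _ ->]; apply/mapP => -[j _ ij].
    have [ji|/u_conj[_]] := eqVneq j i; last by rewrite ij eqxx.
    have [x ux] : exists x, u i = iota x by apply: expf_card_image; rewrite -/q ij ji.
    by case/eqP: (uK i x).
  - rewrite map_inj_uniq ?enum_uniq // => i j h; apply: u_inj.
    by apply: (@frob_inj K L iota 1); rewrite /= expn1.
rewrite size_map_poly size_cat !size_map -enumT size_enum_ord addnn -mul2n ltnNge.
by rewrite (leq_trans (size_polyD _ _)) // size_polyN geq_max !size_npoly.
Qed.

(** Translation by a polynomial of degree less than [2 * k <= n] permutes the monic polynomials of
    degree [n], so the sum may be averaged over these translates. By [eval_bij] the values at the
    [u i] then run over all tuples, the inner sum factors over [i], and the factor [i0] is zero. *)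
Lemma lcoef_eq0 i0 n : ~~ (d %| a i0)%N -> (2 * k <= n)%N -> lcoef Psi n = 0.
Proof.
move=> da kn; rewrite /lcoef /monics big_image /=.
pose inc (s : {poly_(2 * k) K}) : {poly_n K} := npolyp n (val s).
have incE (s : {poly_(2 * k) K}) : val (inc s) = val s.
  by rewrite /= npolypK // (leq_trans (size_npoly _)).
have shift (s : {poly_(2 * k) K}) : \sum_(p : {poly_n K}) Psi ('X^n + val p) =
    \sum_(p : {poly_n K}) Psi ('X^n + val p + val s).
  rewrite (reindex_inj (addIr (inc s))) /=; apply: eq_bigr => p _.
  by rewrite -addrA -incE.
have : #|{: {poly_(2 * k) K}}|%:R * \sum_(p : {poly_n K}) Psi ('X^n + val p) = 0.
  rewrite mulr_natl -sumr_const.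
  rewrite (eq_bigr _ (fun s _ => shift s)) exchange_big big1 // => p _ /=.
  pose A i := (map_poly iota ('X^n + val p)).[u i].
  transitivity (\sum_(y : {ffun 'I_k -> L}) \prod_i chi (A i + y i) ^+ a i).
    rewrite [RHS](reindex _ (onW_bij _ eval_bij)); apply: eq_bigr => s _.
    by apply: eq_bigr => i _; rewrite ffunE rmorphD hornerD.
  rewrite -(bigA_distr_bigA (fun i y => chi (A i + y) ^+ a i)).
  by rewrite (bigD1 i0) //= (sum_char_shift chiP _ da) mul0r.
move/eqP; rewrite mulf_eq0 pnatr_eq0 card_npoly expn_eq0.
by rewrite (gtn_eqF (ltnW (finNzRing_gt1 K))) => /eqP.
Qed.

End LFunction.

(** * Power sums as character sums over extensions *)

Section PowerSumBound.
Variables (K L : finFieldType) (iota : {rmorphism K -> L}) (k : nat).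
Variables (u : 'I_k -> L) (a : 'I_k -> nat).
Variables (d : nat) (w : L) (z : algC) (chi : L -> algC).
Let q := #|K|.
Hypothesis cL : #|L| = (q ^ 2)%N.
Hypothesis chiP : is_char d w z chi.
Hypothesis uK : forall i x, u i != iota x.
Hypothesis u_conj : forall i j, i != j -> u i != u j /\ u i != u j ^+ q.
Hypothesis d_gt1 : (1 < d)%N.
Hypothesis a_gcd : forall e, (forall i, d %| e * a i)%N -> (d %| e)%N.

Section Fixed.
Variables (t : nat) (E : finFieldType) (j : {rmorphism L -> E}).
Hypotheses (t_gt0 : (0 < t)%N) (cE : #|E| = (q ^ (4 * t))%N).

Let f : {rmorphism K -> E} := j \o iota.
Let N := #|L|.-1.
Let M := (\sum_(l < 2 * t) (q ^ 2) ^ l)%N.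
(* The norm [h i x ^+ M] from [E] to [L] of [h i x] is the value at [u i] of the
   characteristic polynomial of [x] over [K]. *)
Let h i x : E := (j (u i) - x) * (j (u i) ^+ q - x) ^+ q.
Let F x : E := \prod_i h i x ^+ a i.
Let zeta : E := j (w ^+ (N %/ d)).
(** In [G'] it is applied only to norms, which lie in the image of [j] by [norm_image], so the
    default [0] of [odflt] is not reached. *)
Let jinv (y : E) : L := odflt 0 [pick b | j b == y].
Let G' x := \prod_i chi (jinv (h i x ^+ M)) ^+ a i.

Lemma card_norm_exp : (#|E|.-1 = M * N)%N.
Proof.
by rewrite cE -[4%N]/(2 * 2)%N -mulnA expnM predn_exp mulnC /N cL.
Qed.

Lemma M_gt0 : (0 < M)%N.
Proof. by have := card_pred_gt0 E; rewrite card_norm_exp muln_gt0 => /andP[]. Qed.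

Lemma jinvK b : jinv (j b) = b.
Proof.
by rewrite /jinv; case: pickP => [c /eqP/fmorph_inj|/(_ b)] //=; rewrite eqxx.
Qed.

Lemma norm_image y : exists b : L, y ^+ M = j b.
Proof.
apply: expf_card_image; have [->|y0] := eqVneq y 0.
  by rewrite exprAC expr0n gtn_eqF // ltnW // finNzRing_gt1.
rewrite -exprM -(prednK (ltnW (finNzRing_gt1 L))) mulnS exprD -/N -card_norm_exp.
by rewrite expf_card_pred // mulr1.
Qed.

(** Pair the factors [l = 2s] and [l = 2s + 1]: since [u i] is fixed by the [q ^ 2]-power map, they
    are the [q ^ (2s)]-th powers of [j (u i) - x] and of [(j (u i) ^+ q - x) ^+ q]. *)
Lemma norm_charpoly g x i :
  map_poly f g = \prod_(0 <= l < 4 * t) ('X - (x ^+ (q ^ l))%:P) ->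
  j (map_poly iota g).[u i] = h i x ^+ M.
Proof.
move=> gx; rewrite -horner_map -map_poly_comp gx horner_prod.
have pq l : [pchar E].-nat (q ^ l)%N by rewrite pnatX (card_pchar_nat f).
have hy : j (u i) ^+ (q ^ 2) = j (u i) by rewrite -rmorphXn -cL expf_card.
have hyl l : j (u i) ^+ ((q ^ 2) ^ l) = j (u i).
  by elim: l => [|l IHl]; rewrite ?expr1 // expnS exprM hy.
rewrite -[4%N]/(2 * 2)%N -mulnA /M; elim: (2 * t)%N => [|m IHm].
  by rewrite big_geq // big_ord0.
rewrite big_ord_recr /= exprD -IHm mulnS add2n !big_nat_recr //= -mulrA.
congr (_ * _); rewrite !hornerXsubC /h exprMn -!expnM.
rewrite exprBn_pchar // expnM hyl; congr (_ * _).
rewrite -exprM -expnM -expnS exprBn_pchar //; congr (_ - _).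
by rewrite -exprM -expnS -[(2 * m).+2]/(2 + 2 * m)%N -mulnS expnM hyl.
Qed.

Lemma lpow_points : lpow (Psi iota u a chi) (4 * t) = \sum_x G' x.
Proof.
rewrite -(@sum_irr_points K E f (4 * t) _ cE _ (Psi iota u a chi)) ?muln_gt0 //.
  rewrite /lpow; apply: eq_bigr => e _; apply: eq_bigr => P _.
  by rewrite (PsiX (Psi1 _ _ _ chiP) (PsiM _ _ _ chiP)).
move=> g x gx; apply: eq_bigr => i _.
by rewrite -(norm_charpoly i gx) jinvK.
Qed.

Lemma zeta_prim : d.-primitive_root zeta.
Proof.
rewrite fmorph_primitive_root; apply: dvdn_prim_root (dvdn_char chiP).
by case: chiP.
Qed.

Lemma G'E x : exists y, [/\ G' x = chi y, j y = F x ^+ M & (y == 0) = (F x == 0)].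
Proof.
exists (\prod_i jinv (h i x ^+ M) ^+ a i).
have jE : j (\prod_i jinv (h i x ^+ M) ^+ a i) = F x ^+ M.
  rewrite rmorph_prod -prodrXl; apply: eq_bigr => i _.
  have [b hb] := norm_image (h i x).
  by rewrite hb jinvK rmorphXn /= -hb exprAC.
split=> //; last by rewrite -(fmorph_eq0 j) jE expf_eq0 M_gt0.
by rewrite (char_prod chiP); apply: eq_bigr => i _; rewrite (charX chiP).
Qed.

Lemma G'_zero x : F x = 0 -> G' x = 0.
Proof.
have [y [-> _ yF]] := G'E x => F0; move: yF; rewrite F0 eqxx => /eqP ->.
by case: chiP.
Qed.

(** [F x ^+ M] is the norm of [F x] to [L]; its power [N %/ d] is a [d]-th root of unity, whose
    index is the one read off by [chi]. So [d] classes partition the points with [F x != 0]. *)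
Lemma G'_class x : F x != 0 -> exists e0 : 'I_d, G' x = z ^+ e0 /\
  forall e : 'I_d, (F x ^+ (M * (N %/ d)) == zeta ^+ e) = (e == e0).
Proof.
have [y [-> jy yF]] := G'E x => F0; have [pw pz h0 hw] := chiP.
have [s ys] : exists s, y = w ^+ s by apply: prim_root_log; rewrite // yF.
have d0 : (0 < d)%N by apply: ltnW.
exists (Ordinal (ltn_pmod s d0)); split; first by rewrite ys hw /= prim_expr_mod.
move=> e; rewrite exprM -jy ys -rmorphXn -exprM mulnC exprM rmorphXn -/zeta.
by rewrite (eq_prim_root_expr zeta_prim) (modn_small (ltn_ord e)) eq_sym.
Qed.

(** [F] as a polynomial function: roots [u i] of multiplicity [a i] and [u i ^+ q] of multiplicity
    [q * a i]; [c] collects the signs from [u i - x] to [x - u i]. The degree does not grow with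
    [t]. *)
Let W (i : 'I_k * bool) : E := if i.2 then j (u i.1) ^+ q else j (u i.1).
Let b (i : 'I_k * bool) := if i.2 then (q * a i.1)%N else a i.1.
Let c : E := \prod_i ((-1) * (-1) ^+ q) ^+ a i.
Let fE : {poly E} := c *: \prod_i ('X - (W i)%:P) ^+ b i.

Lemma W_inj : injective W.
Proof.
have u_inj i i' : u i = u i' -> i = i'.
  by move=> /eqP h0; apply/eqP/negPn/negP => /u_conj[]; rewrite h0.
have conj_neq i i' : u i != u i' ^+ q.
  have [ii|/u_conj[] //] := eqVneq i i'; apply/negP => /eqP uq.
  have [x ux] : exists x, u i = iota x by apply: expf_card_image; rewrite -/q {2}uq ii //.
  by case/eqP: (uK i x).
move=> [i []] [i' []]; rewrite /W /= -?rmorphXn => /fmorph_inj h0.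
- congr (_, _); apply: u_inj; apply: (@frob_inj K L iota 1).
  by rewrite /= expn1.
- by have := conj_neq i' i; rewrite h0 eqxx.
- by have := conj_neq i i'; rewrite h0 eqxx.
- by congr (_, _); apply: u_inj.
Qed.

Lemma fE_horner x : fE.[x] = F x.
Proof.
rewrite hornerZ horner_prod.
have -> : \prod_i (('X - (W i)%:P) ^+ b i).[x] =
    \prod_i ((x - j (u i)) * (x - j (u i) ^+ q) ^+ q) ^+ a i.
  rewrite -(pair_bigA _ (fun i v => (('X - (W (i, v))%:P) ^+ b (i, v)).[x])) /=.
  apply: eq_bigr => i _; rewrite big_bool /= !horner_exp !hornerXsubC /W /b /=.
  by rewrite exprMn exprM mulrC.
rewrite /c -big_split; apply: eq_bigr => i _ /=; rewrite -exprMn /h; congr (_ ^+ _).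
by rewrite mulrACA -exprMn !mulN1r !opprB.
Qed.

Lemma c_neq0 : c != 0.
Proof.
apply/prodf_neq0 => i _.
by rewrite expf_neq0 // mulf_neq0 ?expf_neq0 // oppr_eq0 oner_eq0.
Qed.

Let r := (q ^ (2 * t))%N.
Let m := (\sum_i b i)%N.
Let uu := (r.-1 %/ d)%N.

Lemma d_dvd_r : (d %| r.-1)%N.
Proof.
rewrite /r expnM predn_exp dvdn_mulr //.
by have := dvdn_char chiP; rewrite cL.
Qed.

Lemma r_gt0 : (0 < r)%N.
Proof. by rewrite expn_gt0 ltnW // finNzRing_gt1. Qed.

Lemma r_eq : r = (d * uu).+1.
Proof. by rewrite mulnC divnK ?d_dvd_r // prednK ?r_gt0. Qed.

Lemma cE_r : #|E| = (r ^ 2)%N.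
Proof. by rewrite cE -expnM; congr (_ ^ _)%N; ring. Qed.

(** Times [d], both sides are [#|E| - 1 = (r - 1) * (r + 1)]. The right-hand side is the exponent in
    [stepanov]. *)
Lemma exp_eq : (M * (N %/ d) = uu * r.+1)%N.
Proof.
apply/eqP; rewrite -(eqn_pmul2l (ltnW d_gt1)); apply/eqP.
rewrite mulnCA [(d * _)%N]mulnC divnK ?(dvdn_char chiP) // -card_norm_exp mulnA cE_r.
have -> : (d * uu = r.-1)%N by rewrite [in RHS]r_eq.
case: r r_gt0 => // s _; rewrite -[s.+1.-1]/s.
by have -> : (s.+1 ^ 2 = (s * s.+2).+1)%N by ring.
Qed.

Lemma class_card e : (1 < uu)%N -> (2 * m <= uu)%N ->
  (d * #|[set x : E | F x ^+ (M * (N %/ d)) == zeta ^+ e]|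
    <= r ^ 2 + (3 * d * m + 1) * r)%N.
Proof.
move=> uu1 mu.
have -> : [set x : E | F x ^+ (M * (N %/ d)) == zeta ^+ e] =
    [set x : E | fE.[x] ^+ (uu * r.+1) == zeta ^+ e].
  by apply/setP => x; rewrite !inE fE_horner exp_eq.
apply: stepanov => //; rewrite ?c_neq0 //.
- by rewrite /r pnatX (card_pchar_nat f).
- exact: cE_r.
- exact: r_eq.
- exact: W_inj.
- by move=> e' he; apply: a_gcd => i; have := he (i, false).
- by rewrite expf_neq0 // (prim_root_eq0 zeta_prim) gtn_eqF // ltnW.
Qed.

Lemma zeros_card : (#|[set x | F x == 0%R]| <= m)%N.
Proof.
have sf : size fE = m.+1 by rewrite size_scale ?c_neq0 // size_prod_XsubCX.
rewrite -ltnS -sf cardE; apply: max_poly_roots; last exact: enum_uniq.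
  by rewrite -size_poly_eq0 sf.
by apply/allP => x; rewrite mem_enum inE -fE_horner.
Qed.

Lemma points_bound :
  `|\sum_x G' x| <= ((3 * d * m + 1 + m) + (d * (2 * m + 2) + 1))%:R * r%:R :> algC.
Proof.
have G'1 x : `|G' x| <= 1.
  by have [y [-> _ _]] := G'E x; apply: char_norm chiP _.
(* For small [uu] the trivial bound [#|E| = r * r] is enough: then [r <= d * (2 * m + 2) + 1], which
   is the second summand of the constant. *)
have [uu_small|uu_big] := ltnP uu (2 * m + 2).
  apply: le_trans (ler_norm_sum _ _ _) _.
  apply: (@le_trans _ _ (\sum_(x : E) 1)); first exact: ler_sum.
  rewrite sumr_const -[#|_|]/#|E| cE_r -natrM ler_nat expnS expn1 leq_mul2r.
  apply/orP; right; rewrite {1}r_eq -addn1 addnA leq_add2r (leq_trans _ (leq_addl _ _)) //.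
  by rewrite leq_mul2l (ltnW uu_small) orbT.
pose T e := #|[set x : E | F x ^+ (M * (N %/ d)) == zeta ^+ e]|.
have hT (e : 'I_d) : (d * T e <= r ^ 2 + (3 * d * m + 1) * r)%N.
  by apply: class_card; lia.
have SE : \sum_x G' x = \sum_(e < d) z ^+ e * (T e)%:R.
  transitivity (\sum_x \sum_(e < d)
      (if F x ^+ (M * (N %/ d)) == zeta ^+ e then z ^+ e else 0)).
    apply: eq_bigr => x _; have [F0|F0] := eqVneq (F x) 0.
      rewrite G'_zero // F0 big1 // => e _; case: eqP => // /esym/eqP.
      rewrite expr0n exp_eq muln_eq0 gtn_eqF ?(leq_trans _ uu_big) ?addn2 //= expf_eq0.
      by rewrite (prim_root_eq0 zeta_prim) (gtn_eqF (ltnW d_gt1)) andbF.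
    have [e0 [-> he]] := G'_class F0.
    by rewrite (bigD1 e0) //= he eqxx big1 ?addr0 // => e /negPf ee; rewrite he ee.
  rewrite exchange_big; apply: eq_bigr => e _; rewrite -big_mkcond /= sumr_const.
  by rewrite mulr_natr /T cardsE.
have TE : (#|E| <= m + \sum_(e < d) T e)%N.
  rewrite -(cardC [set x | F x == 0%R]) leq_add ?zeros_card //.
  have -> : (\sum_(e < d) T e = \sum_(x : E) \sum_(e < d)
      (F x ^+ (M * (N %/ d)) == zeta ^+ e))%N.
    rewrite exchange_big; apply: eq_bigr => e _; rewrite /T -sum1_card big_mkcond.
    by apply: eq_bigr => x _; rewrite inE; case: eqP.
  rewrite -sum1_card big_mkcond leq_sum // => x _; rewrite !inE.
  have [//|F0] := eqVneq (F x) 0; have [e0 [_ he]] := G'_class F0.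
  by rewrite (bigD1 e0) //= he eqxx.
have [_ pz _ _] := chiP.
have sum_z : \sum_(e < d) z ^+ e = 0.
  have := subrX1 z d; rewrite (prim_expr_order pz) subrr => /esym/eqP.
  rewrite mulf_eq0 subr_eq0 -[z == 1]/(z ^+ 1 == 1) -(prim_order_dvd pz) gtnNdvd //=.
  by move/eqP.
(* The [z ^+ e] add up to zero, so the upper bound of [hT] can be subtracted from every class. *)
have dS : d%:R * \sum_x G' x =
    \sum_(e < d) z ^+ e * ((d * T e)%:R - (r ^ 2 + (3 * d * m + 1) * r)%:R).
  under [RHS]eq_bigr => e _ do rewrite mulrBr natrM mulrCA.
  by rewrite sumrB -mulr_suml sum_z mul0r subr0 -mulr_sumr SE.
rewrite natrD mulrDl -[leLHS]addr0 lerD ?mulr_ge0 ?ler0n //.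
have d0 : (0 < d%:R :> algC) by rewrite ltr0n ltnW.
rewrite -(ler_pM2l d0) -[X in X * `|_|]normr_nat -normrM dS.
apply: le_trans (ler_norm_sum _ _ _) _.
(* By [hT] all differences have the same sign, so their absolute values add up to the total deficit,
   which is small because by [TE] the classes miss at most [m] points. *)
apply: (@le_trans _ _ (\sum_(e < d) ((r ^ 2 + (3 * d * m + 1) * r)%:R - (d * T e)%:R))).
  apply: ler_sum => e _; rewrite normrM normrX.
  have -> : `|z| = 1.
    apply/eqP; rewrite -(@pexpr_eq1 _ _ d) ?(ltnW d_gt1) //.
    by rewrite -normrX (prim_expr_order pz) normr1.
  by rewrite expr1n mul1r distrC ger0_norm // subr_ge0 ler_nat.
rewrite sumrB sumr_const card_ord -natr_sum -big_distrr /= lerBlDr.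
rewrite -[_ *+ d]mulr_natl -!natrM -natrD ler_nat -mulnDr leq_mul2l; apply/orP; right.
move: TE; rewrite cE_r => TE; have := leq_pmulr m r_gt0; move: (\sum_(e < d) _)%N TE => s.
move: (3 * d * m + 1)%N => v; rewrite mulnDl; lia.
Qed.

End Fixed.

Lemma lpow_bound : exists B, forall t, (0 < t)%N ->
  `|lpow (Psi iota u a chi) (4 * t)| <= B * (q ^ (2 * t))%:R.
Proof.
(* [B] is fixed before [t] is introduced: the constant of [points_bound] depends only on [d], [q]
   and the exponents. An extension of [L] of degree [2 * t] has degree [4 * t] over [K]. *)
eexists => t t0.
have [|E [j cE]] := @finField_ext L (2 * t); first by rewrite muln_gt0.
have cE' : #|E| = (q ^ (4 * t))%N by rewrite cE cL -expnM mulnA.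
rewrite (lpow_points j t0 cE'); apply: (points_bound j t0 cE').
Qed.

End PowerSumBound.

(** * Bounds for character sums over [K] *)

Section WeilBound.
Variables (K L : finFieldType) (iota : {rmorphism K -> L}) (k : nat).
Variables (u : 'I_k -> L).
Let q := #|K|.
Hypothesis cL : #|L| = (q ^ 2)%N.
Hypothesis uK : forall i x, u i != iota x.
Hypothesis u_conj : forall i j, i != j -> u i != u j /\ u i != u j ^+ q.

Lemma weil_bound_coprime (a : 'I_k -> nat) d w z chi :
  @is_char L d w z chi -> (1 < d)%N ->
  (forall e, (forall i, d %| e * a i) -> d %| e)%N ->
  `|\sum_x \prod_i chi (iota x + u i) ^+ a i| <= (2 * k).-1%:R * sqrtC q%:R.
Proof.
move=> chiP d1 a_gcd; have q0 : (0 < q)%N by rewrite ltnW // finNzRing_gt1.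
have [i0 ai0] : exists i0, ~~ (d %| a i0)%N.
  apply/existsP; apply: contraTT d1; rewrite negb_exists => /forallP h.
  rewrite -leqNgt; apply: dvdn_leq => //; apply: a_gcd => i.
  by rewrite mul1n; apply/negPn/h.
have k0 : (0 < k)%N by apply: leq_ltn_trans (ltn_ord i0).
have [B hB] := lpow_bound cL chiP uK u_conj d1 a_gcd.
rewrite -(lcoef1 iota u a chi).
apply: (@first_coef_bound _ (lpow (Psi iota u a chi)) _ 4 B) => //.
- by rewrite sqrtC_gt0 ltr0n.
- exact: lcoef0 chiP.
- move=> n; rewrite prednK ?muln_gt0 // => kn.
  exact: (lcoef_eq0 cL chiP uK u_conj ai0).
- exact: (lcoef_recurrence (Psi1 _ _ _ chiP) (PsiM _ _ _ chiP)).
- move=> t t0; apply: le_trans (hB t t0) _.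
  by rewrite -[4%N]/(2 * 2)%N -mulnA exprM sqrtCK natrX.
Qed.

(** With [g] the gcd of [d] and all the [a i], the power [chi ^+ g] is a character of order
    [d %/ g], and the [a i %/ g] have no factor in common with this order. The hypothesis on [a i0]
    keeps the order above [1]. *)
Lemma weil_bound (a : 'I_k -> nat) d w z chi i0 :
  @is_char L d w z chi -> ~~ (d %| a i0)%N ->
  `|\sum_x \prod_i chi (iota x + u i) ^+ a i| <= (2 * k).-1%:R * sqrtC q%:R.
Proof.
move=> chiP ai0; have [pw pz h0 hw] := chiP; have d0 := prim_order_gt0 pz.
pose G := \big[gcdn/0%N]_i a i; pose g := gcdn d G.
have g0 : (0 < g)%N by rewrite gcdn_gt0 d0.
have gd : (g %| d)%N by apply: dvdn_gcdl.
have ga i : (g %| a i)%N.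
  have /dvdn_biggcdP h : (g %| G)%N by apply: dvdn_gcdr.
  exact: h.
have chiP' : is_char (d %/ g) w (z ^+ g) (fun y => chi y ^+ g).
  split=> //; last by move=> i; rewrite hw exprAC.
    by have := exp_prim_root pz g; rewrite (gcdn_idPl gd).
  by rewrite h0 expr0n gtn_eqF.
have -> : \sum_x \prod_i chi (iota x + u i) ^+ a i =
    \sum_x \prod_i (chi (iota x + u i) ^+ g) ^+ (a i %/ g).
  apply: eq_bigr => x _; apply: eq_bigr => i _.
  by rewrite -exprM mulnC divnK.
apply: (@weil_bound_coprime (fun i => a i %/ g)%N _ _ _ _ chiP').
  rewrite ltn_neqAle divn_gt0 // (dvdn_leq d0 gd) andbT eq_sym.
  apply: contra ai0 => /eqP dg.
  by apply: dvdn_trans (ga i0); rewrite -{1}(divnK gd) dg mul1n.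
move=> e he; rewrite -(dvdn_pmul2r g0) divnK //.
have -> : (e * g = gcdn (e * d) (\big[gcdn/0%N]_i (e * a i)))%N.
  rewrite /g muln_gcdr; congr gcdn.
  by rewrite (big_morph (muln e) (muln_gcdr e) (muln0 e)).
rewrite dvdn_gcd dvdn_mull //=; apply/dvdn_biggcdP => i _.
by rewrite -(divnK (ga i)) mulnA -{1}(divnK gd) dvdn_pmul2r.
Qed.

End WeilBound.

(** * Counting the solutions *)

Lemma solutions_bound (d k : nat) (K L : finFieldType) (iota : {rmorphism K -> L})
    (v : 'I_k -> L) (q := #|K|) :
    (0 < d)%N -> #|L| = (q ^ 2)%N -> (d %| #|L|.-1)%N -> (0 < k)%N ->
    (forall i x, v i != iota x) ->
    (forall i j, i != j -> ~~ galois_conjugates q (v i) (v j)) ->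
  `|(d%:R ^+ k * #|solutions iota q d v|%:R - q%:R : algC)|
    <= d%:R ^+ k * ((2 * k).-1%:R * sqrtC q%:R).
Proof.
move=> d0 cL dL k0 hv hconj; have [w [z [chi chiP]]] := exists_char dL.
(* The sign makes [iota x - v i] the value at [u i] of the monic polynomial ['X + x%:P]. *)
pose u i := - v i.
have uK i x : u i != iota x.
  by rewrite /u eqr_oppLR -rmorphN.
have u_conj i j : i != j -> u i != u j /\ u i != u j ^+ q.
  move=> ij; have pq : [pchar L].-nat q by apply: card_pchar_nat iota.
  have := hconj j i; rewrite eq_sym ij => /(_ isT); rewrite negb_or => /andP[h1 h2].
  by rewrite /u exprNn_pchar // !eqr_opp.
pose S (a : {ffun 'I_k -> 'I_d}) := \sum_x \prod_i chi (iota x + u i) ^+ a i.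
have y0 x i : iota x + u i != 0 by rewrite addr_eq0 /u opprK eq_sym hv.
(* Orthogonality turns [d] times each indicator into a sum over ['I_d], as no argument of [chi] is
   zero by [y0]; the product over [i] then expands over [{ffun 'I_k -> 'I_d}]. *)
have sumE : d%:R ^+ k * #|solutions iota q d v|%:R = \sum_a S a.
  rewrite exchange_big /= -sum1_card natr_sum mulr_sumr big_mkcond /=.
  apply: eq_bigr => x _.
  rewrite -(bigA_distr_bigA (fun i (e : 'I_d) => chi (iota x + u i) ^+ e)) /=.
  under [RHS]eq_bigr => i _ do rewrite (sum_char_pow chiP (y0 x i)).
  rewrite inE; case: ifP => [/forallP h|/negbT].
    rewrite mulr1 -[in LHS](card_ord k) -prodr_const; apply: eq_bigr => i _.
    by have := h i; rewrite subn1 -cL => ->.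
  rewrite negb_forall => /existsP[i]; rewrite subn1 -cL => /negPf hi.
  by rewrite (bigD1 i) //= hi mul0r.
have [a0 Sa0] : exists a0 : {ffun 'I_k -> 'I_d}, forall i, a0 i = 0%N :> nat.
  by exists [ffun=> Ordinal d0] => i; rewrite ffunE.
have S0 : S a0 = q%:R.
  rewrite /S (eq_bigr (fun=> 1)) ?sumr_const // => x _.
  by apply: big1 => i _; rewrite Sa0 expr0.
rewrite sumE (bigD1 a0) //= S0 addrC addrK.
apply: le_trans (ler_norm_sum _ _ _) _.
have b0 : 0 <= (2 * k).-1%:R * sqrtC q%:R :> algC.
  by rewrite mulr_ge0 ?ler0n // sqrtC_ge0 ler0n.
(* The [d ^ k - 1] terms other than [a0] are bounded as if there were [d ^ k]. *)
apply: (@le_trans _ _ (\sum_(a : {ffun 'I_k -> 'I_d})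
    ((2 * k).-1%:R * sqrtC q%:R))); last first.
  by rewrite sumr_const card_ffun !card_ord -[leLHS]mulr_natl natrX.
rewrite [leRHS](bigD1 a0) //= -[leLHS]add0r lerD // ler_sum // => a aa0.
have [i ai] : exists i, ~~ (d %| a i)%N.
  apply/existsP; apply: contraNT aa0; rewrite negb_exists => /forallP h.
  apply/eqP/ffunP => i; apply/val_inj; rewrite /= Sa0.
  apply/eqP; have := h i; rewrite negbK; apply: contraTT.
  by rewrite -lt0n => ai; rewrite gtnNdvd.
exact: (weil_bound cL uK u_conj chiP ai).
Qed.

Theorem theorem1p3 (R : rcfType) (d q k : nat)
    (K L : finFieldType) (iota : {rmorphism K -> L}) (v : 'I_k -> L)
    (hd : (2 <= d)%N)
    (hK : #|K| = q) (hL : #|L| = (q ^ 2)%N)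
    (hqd : q ^ 2 = 1 %[mod d])
    (hk : (0 < k)%N)
    (hv : forall (i : 'I_k) (x : K), v i != iota x)
    (hconj : forall i j : 'I_k, i != j -> ~~ galois_conjugates q (v i) (v j)) :
  let M := #|solutions iota q d v| in
  `| M%:R - q%:R / d%:R ^+ k | <= (2 * k%:R - 1) * Num.sqrt q%:R :> R.
Proof.
cbv zeta; subst q; set M := #|solutions _ _ _ _|.
have d0 : (0 < d)%N by apply: ltnW.
have dL : (d %| #|L|.-1)%N.
  rewrite hL -subn1 -eqn_mod_dvd ?expn_gt0 ?(ltnW (finNzRing_gt1 K)) //.
  by rewrite hqd.
have := solutions_bound d0 hL dL hk hv hconj; rewrite -/M.
set q := #|K|; move: M => M {hv hconj iota v hL dL hqd}.
(* The bound is known in [algC] and wanted in [R]. Cleared of the denominator [d ^ k] and squared,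
   it becomes the inequality [X ^+ 2 <= Y ^ 2 * q] between integers, which transfers. *)
pose X : int := (d ^ k * M)%:Z - q%:Z; pose Y : nat := (d ^ k * (2 * k).-1)%N.
move=> hX; have XY : X ^+ 2 <= (Y ^ 2 * q)%:Z.
  have XC : (X%:~R : algC) = d%:R ^+ k * M%:R - q%:R.
    by rewrite /X rmorphB /= -!pmulrn natrM natrX.
  rewrite -(ler_int algC) -[X ^+ 2]real_normK ?num_real // rmorphXn /= intr_norm XC.
  have -> : ((Y ^ 2 * q)%:Z%:~R : algC) = (d%:R ^+ k * ((2 * k).-1%:R * sqrtC q%:R)) ^+ 2.
    by rewrite mulrA exprMn sqrtCK /Y -natrX -natrM -natrX -natrM pmulrn.
  by rewrite lerXn2r // nnegrE ?(le_trans _ hX).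
have dk : 0 < d%:R ^+ k :> R by rewrite exprn_gt0 // ltr0n.
have -> : 2 * k%:R - 1 = (2 * k).-1%:R :> R.
  by rewrite -subn1 natrB ?muln_gt0 // natrM.
rewrite -(ler_pM2l dk) -{1}(gtr0_norm dk) -normrM mulrBr mulrCA divff ?gt_eqF // mulr1.
have -> : d%:R ^+ k * M%:R - q%:R = X%:~R :> R.
  by rewrite /X rmorphB /= -!pmulrn natrM natrX.
have b0 : 0 <= d%:R ^+ k * ((2 * k).-1%:R * Num.sqrt q%:R) :> R.
  by rewrite !mulr_ge0 ?sqrtr_ge0 ?ler0n // ltW.
rewrite -(@ler_pXn2r _ 2) ?nnegrE //.
rewrite mulrA [in leRHS]exprMn sqr_sqrtr ?ler0n // real_normK ?num_real //.
have := XY; rewrite -(ler_int R) rmorphXn /=; congr (_ <= _).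
by rewrite /Y -natrX -natrM -natrX -natrM pmulrn.
Qed.
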